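(* Let $k,a,b,c,r$ be integers with $k\geq c>b>a\geq 1$ and $r\geq 1$. Let $\mathcal{R}_{a,b,c,k}$ be the set of partitions $\pi=(\pi_1,\ldots,\pi_m)$ ($\pi_1\geq\cdots\geq\pi_m$, including the empty partition) such that every part is congruent to $a$, $b$ or $c$ modulo $k$, the parts congruent to $c$ modulo $k$ are distinct, and for $1\leq i<m$, if $\pi_i\equiv a\pmod k$ then $\pi_{i+1}$ is congruent to $a$ or $c$ modulo $k$. Let $\mathcal{R}_{a,b,c,k,r}$ be the set of partitions in $\mathcal{R}_{a,b,c,k}$ for which there is no index $i$ with $\pi_i,\pi_{i+1},\ldots,\pi_{i+r-1}$ all congruent to $b$ modulo $k$. Then \begin{align*} &\sum_{\pi\in\mathcal{R}_{a,b,c,k}}\mu^{\ell_{k,a}(\pi)}\nu^{\ell_{k,b}(\pi)}\omega^{\ell_{k,c}(\pi)}q^{|\pi|}\\ &=1+\sum_{m\geq 1}\frac{1}{(q^k;q^k)_m}\sum_{s,h\geq 0}\mu^{m-h-s}\nu^{h}\omega^sq^{(m-h-s)a+hb+sc+k(s^2-s)/2}{{h+s}\brack {s}}_{k}{{m-h}\brack {s}}_{k}, \end{align*} and \begin{align*} &\sum_{\pi\in\mathcal{R}_{a,b,c,k,r}}\mu^{\ell_{k,a}(\pi)}\nu^{\ell_{k,b}(\pi)}\omega^{\ell_{k,c}(\pi)}q^{|\pi|}\\ &=1+\sum_{m\geq 1}\frac{1}{(q^k;q^k)_m}\sum_{s,h\geq 0}\mu^{m-h-s}\nu^{h}\omega^sq^{(m-h-s)a+hb+sc+k(s^2-s)/2}{{m-h}\brack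 {s}}_{k}\\ &\qquad\qquad\times\sum_{i\geq 0}(-1)^iq^{rk(i^2-i)/2}{{s+1}\brack {i}}_{rk}{{h-ri+s}\brack {s}}_{k}. \end{align*}
   Context: Partitions are finite non-increasing sequences of positive integers; $|\pi|$ is the sum of the parts; for $k\geq d\geq 1$, $\ell_{k,d}(\pi)$ denotes the number of parts of $\pi$ congruent to $d$ modulo $k$. $|q|<1$. $(x;q)_0=1$, $(x;q)_n=(1-x)(1-xq)\cdots(1-xq^{n-1})$. For a positive integer $k$ and integers $A,B$, ${A\brack B}_k=\frac{(q^k;q^k)_A}{(q^k;q^k)_B(q^k;q^k)_{A-B}}$ if $A\geq B\geq 0$, and $0$ otherwise. *)

(* Defs.v *)
From HB Require Import structures.
From mathcomp Require Export all_boot all_order all_algebra.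
From mathcomp Require Export complex finmap.
From mathcomp Require Export all_classical all_reals all_analysis.
From mathcomp.analysis.showcase Require summability.

Set Implicit Arguments.
Unset Strict Implicit.
Unset Printing Implicit Defensive.

Export Order.TTheory GRing.Theory Num.Theory.
Export numFieldNormedType.Exports.

Local Open Scope classical_set_scope.
Local Open Scope ring_scope.
Local Open Scope complex_scope.

Definition is_partition (p : seq nat) : Prop :=
  sorted geq p /\ (0%N \notin p).

Definition ell (k d : nat) (p : seq nat) : nat :=
  count (fun x => x == d %[mod k])%N p.

(* Indices are 0-based: the i-th entry is the (i+1)-st part. *)
Definition Rset (a b c k : nat) : set (seq nat) :=
  [set p | [/\ is_partition p,
      (forall x, x \in p ->
         [\/ x = a %[mod k], x = b %[mod k] | x = c %[mod k]])%N,
      uniq [seq x <- p | (x == c %[mod k])%N] &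
      (forall i, (i.+1 < size p)%N ->
         nth 0 p i = a %[mod k] ->
         nth 0 p i.+1 = a %[mod k] \/ nth 0 p i.+1 = c %[mod k])%N]].

Definition Rset_run (a b c k r : nat) : set (seq nat) :=
  [set p | Rset a b c k p /\
     ~ (exists i, (i + r <= size p)%N /\
          forall j, (j < r)%N -> (nth 0 p (i + j) = b %[mod k])%N)].

Section QSeries.
Variable K : fieldType.

Definition qpoch (x q : K) (n : nat) : K := \prod_(i < n) (1 - x * q ^+ i).

Definition qbin (q : K) (k : nat) (A B : int) : K :=
  if 0 <= B <= A then
    qpoch (q ^+ k) (q ^+ k) `|A|%N /
      (qpoch (q ^+ k) (q ^+ k) `|B|%N * qpoch (q ^+ k) (q ^+ k) `|A - B|%N)
  else 0.

Variables (k a b c : nat) (q mu nu om : K).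

Definition weight (p : seq nat) : K :=
  mu ^+ ell k a p * nu ^+ ell k b p * om ^+ ell k c p * q ^+ sumn p.

Definition monomial (m s h : nat) : K :=
  mu ^+ (m - h - s) * nu ^+ h * om ^+ s *
  q ^+ ((m - h - s) * a + h * b + s * c + k * ((s ^ 2 - s) %/ 2)).

(* The sums over s, h >= 0 run over h + s <= m only: when h + s > m the factor
   qbin q k (m - h) s is 0.  On this range the subtractions in monomial are
   exact.  Likewise qbin q (r * k) (s + 1) i is 0 for i > s + 1. *)
Definition term (m : nat) : K :=
  (qpoch (q ^+ k) (q ^+ k) m)^-1 *
  \sum_(s < m.+1) \sum_(h < (m - s).+1)
    monomial m s h * qbin q k (h%:Z + s%:Z) s%:Z * qbin q k (m%:Z - h%:Z) s%:Z.

Definition term_run (r m : nat) : K :=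
  (qpoch (q ^+ k) (q ^+ k) m)^-1 *
  \sum_(s < m.+1) \sum_(h < (m - s).+1)
    monomial m s h * qbin q k (m%:Z - h%:Z) s%:Z *
    \sum_(i < s.+2)
      (-1) ^+ i * q ^+ (r * k * ((i ^ 2 - i) %/ 2)) *
      qbin q (r * k) (s%:Z + 1) i%:Z *
      qbin q k (h%:Z - r%:Z * i%:Z + s%:Z) s%:Z.

End QSeries.

(* Convergence of the sum of f over the possibly infinite index set A along the
   net of finite subsets of A, i.e. unconditional (equivalently, absolute)
   convergence.  R[i]^o is R[i] with the topology of its modulus. *)
Definition sums_to (R : realType) (T : choiceType) (A : set T)
    (f : T -> R[i]) (S : R[i]) : Prop :=
  (summability.partial_sum (fun x : A => f (val x)) : {fset A} -> R[i]^o)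
    @ summability.totally --> (S : R[i]^o).

Definition series_from1_to (R : realType) (t : nat -> R[i]) (S : R[i]) : Prop :=
  (fun n => \sum_(1 <= m < n) t m : R[i]^o) @ \oo --> (S : R[i]^o).

(* Main.v *)
Require Import Defs.
From mathcomp Require Import ring lra zify.

Set Implicit Arguments.
Unset Strict Implicit.
Unset Printing Implicit Defensive.

Local Open Scope classical_set_scope.
Local Open Scope ring_scope.
Local Open Scope complex_scope.

(** Write each part as [k * j + d] with [d] one of [a], [b], [c]. Along a
    partition in the set, the quotients [j] weakly decrease, and strictly so
    exactly in front of a part of class [c]; the word of classes is any word
    without the factor [ab]. For a word of length [m] with its [c]'s at the
    (0-based) positions [P], the quotients thus contribute [Q ^ (sum of P)]
    divided by [(Q; Q)_m], where [Q = q ^ k]. A word with [s] letters [c]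
    splits into [s + 1] segments [b...ba...a], and summing [Q ^ (sum of P)]
    over the distributions of the [a]'s and of the [b]'s among the segments
    gives the two q-binomials. When at most [r - 1] letters [b] fit into a
    segment, the generating function of the [b]-distribution is multiplied by
    [prod_(j <= s) (1 - (z Q^j)^r)], which the q-binomial theorem expands into
    the alternating sum. The first identity is, in length [m], the second one
    with [r > m].

    Convergence: with the quotients bounded by [L], the sum over partitions of
    length [m] is a finite combination of q-binomials, which tends to the
    [m]-th term as [L] grows; the same computation with absolute values gives
    a uniform bound on all finite sums. *)

(** * q-binomials and bounded distributions *)

Section QBinomial.
Variables (K : fieldType) (Q : K).
Hypothesis Q_pow_neq1 : forall i, 1 - Q ^+ i.+1 != 0.

(** The q-binomial of [n + s] over [s], indexed by two complementary entries so that it is symmetric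
    and free of subtraction. *)
Definition gbin (n s : nat) : K :=
  qpoch Q Q (n + s) / (qpoch Q Q n * qpoch Q Q s).

Lemma qpochS n : qpoch Q Q n.+1 = qpoch Q Q n * (1 - Q ^+ n.+1).
Proof. by rewrite /qpoch big_ord_recr /= exprS. Qed.

Lemma qpoch_neq0 n : qpoch Q Q n != 0.
Proof.
by apply/prodf_neq0 => i _; rewrite -exprS.
Qed.

Lemma gbinC n s : gbin n s = gbin s n.
Proof. by rewrite /gbin addnC [_ * qpoch _ _ s]mulrC. Qed.

Lemma gbinn0 n : gbin n 0 = 1.
Proof.
by rewrite /gbin addn0 {3}/qpoch big_ord0 mulr1 divff // qpoch_neq0.
Qed.

Lemma gbin0n n : gbin 0 n = 1.
Proof. by rewrite gbinC gbinn0. Qed.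

(** After clearing denominators this is [1 - Q^(n+s+2) = (1 - Q^(s+1)) + Q^(s+1) (1 - Q^(n+1))]. *)
Lemma gbinS n s : gbin n.+1 s.+1 = gbin n.+1 s + Q ^+ s.+1 * gbin n s.+1.
Proof.
rewrite /gbin addSnnS !addnS !qpochS.
have := qpoch_neq0 n; have := qpoch_neq0 s.
have := Q_pow_neq1 n; have := Q_pow_neq1 s.
rewrite (_ : (n + s).+2 = (n.+1 + s.+1)%N) ?exprD; last by lia.
move=> *; field; do ?[apply/andP; split] => //.
Qed.

Definition gbin_tot (n i : nat) : K :=
  if (i <= n)%N then gbin (n - i) i else 0.

(** The dual q-Pascal rule, from [gbinS] by symmetry; for [i = n] the first summand is the default
    value 0. *)
Lemma gbin_totS n i : (i <= n)%N ->
  gbin_tot n.+1 i.+1 = gbin_tot n i.+1 + Q ^+ (n - i) * gbin_tot n i.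
Proof.
move=> le_in; rewrite /gbin_tot ltnS le_in subSS.
case: ltnP => [lt_in|ge_in]; last first.
  have -> : (n - i = 0)%N by lia.
  by rewrite !gbin0n add0r mul1r.
have -> : (n - i = (n - i.+1).+1)%N by lia.
by rewrite [LHS]gbinC gbinS gbinC [gbin i _]gbinC.
Qed.

End QBinomial.

(** * Compositions with bounded parts and words without the factor [ab] *)

Section Compositions.
Variables (K : fieldType) (Q : K) (e : nat).
Hypothesis Q_pow_neq1 : forall i, 1 - Q ^+ i.+1 != 0.
Local Notation r := e.+1.

(* The sum of [Q ^ (\sum_i i * h_i)] over all [h_0 + ... + h_(s-1) = h] with
   every [h_i <= e]. In [bet t s h] there is one more segment, with at most [t]
   elements. *)
Fixpoint gam (s h : nat) : K :=
  if s is s'.+1 then \sum_(j < r | (j <= h)%N) Q ^+ (s' * j) * gam s' (h - j)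
  else (h == 0%N)%:R.

Definition bet (t s h : nat) : K :=
  \sum_(j < t.+1 | (j <= h)%N) Q ^+ (s * j) * gam s (h - j).

Lemma gamS s h : gam s.+1 h = bet e s h. Proof. by []. Qed.

(** Either the extra segment is empty, or removing one of its elements, of weight [Q ^ s], lowers
    both [t] and [h] by one. *)
Lemma bet_rec t s h : bet t s h = gam s h +
  (if (t, h) is (t'.+1, h'.+1) then Q ^+ s * bet t' s h' else 0).
Proof.
rewrite /bet big_mkcond big_ord_recl /= muln0 expr0 mul1r subn0; congr (_ + _).
case: t => [|t]; first by rewrite big_ord0.
case: h => [|h]; first by rewrite big1.
rewrite [in RHS]big_mkcond big_distrr; apply: eq_bigr => j _ /=.
rewrite /bump /= add1n ltnS subSS; case: ifP; last by rewrite mulr0.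
by rewrite mulrA -exprD mulnS.
Qed.

Lemma bet_recr t s h : bet t.+1 s h = bet t s h +
  (if (t < h)%N then Q ^+ (s * t.+1) * gam s (h - t.+1) else 0).
Proof.
by rewrite /bet big_mkcond big_ord_recr /= -big_mkcond.
Qed.

(** Two expansions of [bet e.+1 s h.+1] are compared: adding an element to the last segment may
    overfill it, and the subtracted term is the case of exactly [r] elements there. *)
Lemma gam_rec s h : gam s.+1 h.+1 = gam s h.+1 + Q ^+ s * gam s.+1 h
  - (if (r <= h.+1)%N then Q ^+ (s * r) * gam s (h.+1 - r) else 0).
Proof.
apply: (canRL (addrK _)).
by rewrite !gamS -[if _ then _ else _]/(if (e < h.+1)%N then _ else _) -bet_recr bet_rec.
Qed.

Lemma gam0 s : gam s 0 = 1.
Proof.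
elim: s => // s IH; rewrite gamS bet_rec IH.
by case: (e) => [|t]; rewrite addr0.
Qed.

(* [gam] without the bound [e]. *)
Definition dist (s n : nat) : K :=
  if s is s'.+1 then gbin Q n s' else (n == 0%N)%:R.

Lemma distS0 s : dist s.+1 0 = 1.
Proof. exact: gbin0n. Qed.

Lemma distSS s n : dist s.+1 n.+1 = dist s n.+1 + Q ^+ s * dist s.+1 n.
Proof.
case: s => [|s] /=; first by rewrite !gbinn0 // add0r mul1r.
by rewrite gbinS.
Qed.

Lemma dist0 s : dist s 0 = 1.
Proof. by case: s => // s; rewrite distS0. Qed.

(** The coefficient of [z^h] in [z^(r i) / (z; Q)_s]. *)
Definition dist_shift (s h i : nat) : K :=
  if (r * i <= h)%N then dist s (h - r * i) else 0.

Lemma dist_shiftS s h i :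
  dist_shift s.+1 h.+1 i = dist_shift s h.+1 i + Q ^+ s * dist_shift s.+1 h i.
Proof.
rewrite /dist_shift; case: (ltngtP (r * i) h.+1) => H.
- by rewrite -ltnS H subSn // distSS.
- by rewrite ifF ?mulr0 ?addr0 //; lia.
- by rewrite H subnn ltnn mulr0 addr0 !dist0.
Qed.

(** The coefficient of [z^h] in [prod_(j < s) (1 - (z Q^j)^r) / (1 - z Q^j)], the numerator being
    expanded by the q-binomial theorem in base [Q ^ r]. *)
Definition sieve (s h : nat) : K :=
  \sum_(i < s.+1) (-1) ^+ i * Q ^+ (r * 'C(i, 2)) * gbin_tot (Q ^+ r) s i *
    dist_shift s h i.

Lemma Qr_pow_neq1 i : 1 - (Q ^+ r) ^+ i.+1 != 0.
Proof.
rewrite -exprM; have -> : (r * i.+1 = (r * i.+1).-1.+1)%N by lia.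
exact: Q_pow_neq1.
Qed.

(** [dist_shiftS] accounts for the new denominator [1 - z Q^s], and the q-Pascal rule in base
    [Q ^ r] for the new factor [1 - (z Q^s)^r]. *)
Lemma sieve_rec s h : sieve s.+1 h.+1 = sieve s h.+1 + Q ^+ s * sieve s.+1 h
  - (if (r <= h.+1)%N then Q ^+ (s * r) * sieve s (h.+1 - r) else 0).
Proof.
have -> : sieve s.+1 h.+1 = Q ^+ s * sieve s.+1 h +
  \sum_(i < s.+2) (-1) ^+ i * Q ^+ (r * 'C(i, 2)) * gbin_tot (Q ^+ r) s.+1 i *
    dist_shift s h.+1 i.
  rewrite /sieve big_distrr -big_split; apply: eq_bigr => i _ /=.
  rewrite dist_shiftS; ring.
rewrite [_ + Q ^+ s * _]addrC -addrA; congr (_ + _).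
rewrite big_ord_recl /=.
have -> : sieve s h.+1 = dist_shift s h.+1 0 +
   \sum_(i < s.+1) (-1) ^+ i.+1 * Q ^+ (r * 'C(i.+1, 2)) *
     gbin_tot (Q ^+ r) s i.+1 * dist_shift s h.+1 i.+1.
  rewrite big_ord_recr /= /gbin_tot ltnn mulr0 mul0r addr0.
  rewrite /sieve big_ord_recl /= /gbin_tot /= gbinn0; last exact: Qr_pow_neq1.
  by rewrite !bin0n /= muln0 expr0 !mul1r.
rewrite {1}/gbin_tot /= gbinn0; last exact: Qr_pow_neq1.
rewrite !bin0n /= muln0 expr0 !mul1r -addrA; congr (_ + _).
have pascal (i : 'I_s.+1) := gbin_totS Qr_pow_neq1 (ltn_ord i : (i <= s)%N).
under eq_bigr => i _ do rewrite /bump /= add1n pascal.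
have -> : (if (r <= h.+1)%N then Q ^+ (s * r) * sieve s (h.+1 - r) else 0) =
  \sum_(i < s.+1) - ((-1) ^+ i.+1 * Q ^+ (r * 'C(i.+1, 2)) *
     (Q ^+ r) ^+ (s - i) * gbin_tot (Q ^+ r) s i * dist_shift s h.+1 i.+1).
  case: ifP => le_rh; last first.
    rewrite big1 // => i _; rewrite /dist_shift.
    by rewrite ifF ?mulr0 ?oppr0 //; apply: contraFF le_rh; lia.
  rewrite /sieve big_distrr; apply: eq_bigr => i _ /=.
  have -> : dist_shift s h.+1 i.+1 = dist_shift s (h.+1 - r) i.
    rewrite /dist_shift mulnS leq_subRL // addnC -subnDA.
    by rewrite [(r * i + r)%N]addnC.
  rewrite -[(Q ^+ r) ^+ _]exprM.
  (* Up to the factor [r], the exponents satisfy [C(i+1, 2) + (s - i) = s + C(i, 2)] for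
     [i <= s]. *)
  have E : Q ^+ (r * 'C(i.+1, 2)) * Q ^+ (r * (s - i)) =
      Q ^+ (s * r) * Q ^+ (r * 'C(i, 2)) :> K.
    rewrite -!exprD; congr (_ ^+ _); rewrite binS bin1.
    have := ltn_ord i; nia.
  transitivity ((-1) ^+ i * (Q ^+ (s * r) * Q ^+ (r * 'C(i, 2))) *
    gbin_tot (Q ^+ r) s i * dist_shift s (h.+1 - r) i); first by ring.
  rewrite -E [(-1) ^+ i.+1]exprS; ring.
rewrite sumrN opprK -big_split; apply: eq_bigr => i _ /=; ring.
Qed.

Lemma sieve0 s : sieve s 0 = 1.
Proof.
rewrite /sieve big_ord_recl big1 => [|i _]; last by rewrite /dist_shift /= mulr0.
rewrite /gbin_tot /dist_shift /= gbinn0; last exact: Qr_pow_neq1.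
by rewrite !muln0 /= dist0 ?muln0 !mulr1 addr0.
Qed.

Lemma gam_sieve s h : gam s h = sieve s h.
Proof.
elim: s h => [|s IHs] h.
  rewrite /sieve big_ord_recl big_ord0 addr0 /gbin_tot /= gbinn0; last exact: Qr_pow_neq1.
  by rewrite /dist_shift !muln0 /= ?muln0 !mul1r subn0.
elim: h => [|h IHh]; first by rewrite gam0 sieve0.
by rewrite gam_rec sieve_rec IHh !IHs.
Qed.

(* The sum of [Q] to the sum of the positions of the [c]'s over the words of
   length [m] with [s] letters [c] and [h] letters [b], without the factor [ab],
   with leading run of [b]'s at most [t] and all other runs at most [e]. *)
Definition cf (m t s h : nat) : K :=
  if (h + s <= m)%N then Q ^+ 'C(s, 2) * gbin Q (m - h - s) s * bet t s h else 0.

(** The summands correspond to a first letter [a], [b], [c]. Deleting it shifts every remaining [c]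
    by one position, hence the power of [Q]. After [a] no [b] may follow, so the cap becomes 0;
    after [c] it is reset to [e]. On the closed form, [bet_rec] separates the case [b], and q-Pascal
    separates [a] from [c]. *)
Lemma cf_rec m t s h : cf m.+1 t s h = Q ^+ s * cf m 0 s h
  + (if (t, h) is (t'.+1, h'.+1) then Q ^+ s * cf m t' s h' else 0)
  + (if s is s'.+1 then Q ^+ s' * cf m e s' h else 0).
Proof.
have -> : Q ^+ s * cf m 0 s h
  + (if (t, h) is (t'.+1, h'.+1) then Q ^+ s * cf m t' s h' else 0)
  + (if s is s'.+1 then Q ^+ s' * cf m e s' h else 0)
  = Q ^+ s * cf m 0 s h + (if s is s'.+1 then Q ^+ s' * cf m e s' h else 0) +
    (if (h + s <= m.+1)%N then Q ^+ 'C(s, 2) * gbin Q (m.+1 - h - s) s *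
    (if (t, h) is (t'.+1, h'.+1) then Q ^+ s * bet t' s h' else 0) else 0).
  rewrite addrAC; congr (_ + _).
  case: t h => [|t] [|h]; rewrite ?mulr0 ?if_same //.
  by rewrite /cf addSn ltnS subSS; case: ifP; rewrite ?mulr0 //; move=> _; ring.
rewrite {1}/cf; case: ifP => hs; last first.
  rewrite addr0 /cf ifF; last by lia.
  rewrite mulr0 add0r; case: s hs => // s hs; rewrite ifF ?mulr0 //; lia.
rewrite bet_rec mulrDr; congr (_ + _).
have -> : gam s h = bet 0 s h by rewrite bet_rec addr0.
case: s hs => [|s] hs.
  rewrite /cf !addn0 !subn0 !gbinn0 // bin0n expr0 !mul1r addr0.
  rewrite addn0 in hs; case: ltnP => // lt_mh.
  have {lt_mh hs} -> : h = m.+1 by lia.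
  by rewrite bet_rec /= addr0.
rewrite /cf; have -> : (h + s <= m)%N by lia.
rewrite -gamS bet_rec addr0 binS bin1 exprD.
case: ifP => hs'; last first.
  have -> : (m.+1 - h - s.+1 = 0)%N by lia.
  have -> : (m - h - s = 0)%N by lia.
  by rewrite !gbin0n //; ring.
have -> : (m.+1 - h - s.+1 = (m - h - s.+1).+1)%N by lia.
have -> : (m - h - s = (m - h - s.+1).+1)%N by lia.
rewrite gbinS //; ring.
Qed.

Lemma cf_eq0 m t s h : (m < h + s)%N -> cf m t s h = 0.
Proof. by rewrite ltnNge /cf => /negbTE ->. Qed.

(** The weight [g] collects the factors that depend only on the number of [c]'s. As [cf] vanishes
    for [h + s > m], any ranges [N1], [N2] above [m] give the same sum, which absorbs the index
    shifts of the recursion. *)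
Definition wsum (A B C : K) (N1 N2 m t : nat) (g : nat -> K) : K :=
  \sum_(s < N1) \sum_(h < N2) A ^+ (m - h - s) * B ^+ h * C ^+ s * cf m t s h * g s.

Lemma wsum_rec A B C N1 N2 m t g :
  wsum A B C N1.+1 N2.+1 m.+1 t g =
  A * wsum A B C N1.+1 N2.+1 m 0 (fun s => Q ^+ s * g s)
  + (if t is t'.+1 then B * wsum A B C N1.+1 N2 m t' (fun s => Q ^+ s * g s)
     else 0)
  + C * wsum A B C N1 N2.+1 m e (fun s => Q ^+ s * g s.+1).
Proof.
(* The truncated subtraction goes wrong only for [h + s > n], where [cf] vanishes. *)
have expA n s h t1 : A ^+ (n.+1 - h - s) * cf n t1 s h =
    A * A ^+ (n - h - s) * cf n t1 s h.
  case: (leqP (h + s) n) => Hn; last by rewrite cf_eq0 ?mulr0.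
  by rewrite -exprS; congr (_ ^+ _ * _); lia.
have -> : (if t is t'.+1 then B * wsum A B C N1.+1 N2 m t' (fun s => Q ^+ s * g s)
     else 0) = \sum_(s < N1.+1) \sum_(h < N2.+1)
  A ^+ (m.+1 - h - s) * B ^+ h * C ^+ s *
   (if (t, nat_of_ord h) is (t'.+1, h'.+1) then Q ^+ s * cf m t' s h' else 0) * g s.
  case: t => [|t].
    by rewrite big1 // => s _; rewrite big1 // => h _; rewrite mulr0 mul0r.
  rewrite /wsum big_distrr; apply: eq_bigr => s _ /=.
  rewrite [RHS]big_ord_recl /= mulr0 mul0r add0r big_distrr.
  by apply: eq_bigr => h _ /=; rewrite subSS exprS; ring.
have -> : C * wsum A B C N1 N2.+1 m e (fun s => Q ^+ s * g s.+1) =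
  \sum_(s < N1.+1) \sum_(h < N2.+1) A ^+ (m.+1 - h - s) * B ^+ h * C ^+ s *
   (if nat_of_ord s is s'.+1 then Q ^+ s' * cf m e s' h else 0) * g s.
  rewrite [RHS]big_ord_recl /= [X in _ = X + _]big1; last first.
    by move=> h _; rewrite mulr0 mul0r.
  rewrite add0r /wsum big_distrr; apply: eq_bigr => s _ /=.
  rewrite big_distrr; apply: eq_bigr => h _ /=.
  rewrite exprS (_ : m.+1 - h - (bump 0 s) = m - h - s)%N; last first.
    by rewrite /bump /=; lia.
  by rewrite /bump /= add1n; ring.
rewrite /wsum big_distrr -!big_split; apply: eq_bigr => s _ /=.
rewrite big_distrr -!big_split; apply: eq_bigr => h _ /=.
rewrite cf_rec mulrDr mulrDl mulrDr mulrDl; congr (_ + _ + _).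
transitivity ((A ^+ (m.+1 - h - s) * cf m 0 s h) * B ^+ h * C ^+ s *
  (Q ^+ s * g s)); first by ring.
rewrite expA; ring.
Qed.

(* [gauss_trunc m s L] is the q-binomial [L - s + m choose m], truncated to 0
   for [L < s]. *)
Definition gauss_trunc (m s L : nat) : K :=
  if (s <= L)%N then qpoch (Q ^+ (L - s).+1) Q m / qpoch Q Q m else 0.

(** This sums over the largest quotient. Induction on [L] starts at [L = s], where both sides are
    [Q ^ s]; the step is [(1 - Q^(d+1)) + Q^(d+1) (1 - Q^(m+1)) = 1 - Q^(d+m+2)]. *)
Lemma gauss_trunc_hockey m s L :
  \sum_(j < L.+1) Q ^+ j * gauss_trunc m s j = Q ^+ s * gauss_trunc m.+1 s L.
Proof.
have base : gauss_trunc m.+1 s s = 1.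
  by rewrite /gauss_trunc leqnn subnn expr1 divff // qpoch_neq0.
have base' : gauss_trunc m s s = 1.
  by rewrite /gauss_trunc leqnn subnn expr1 divff // qpoch_neq0.
case: (leqP s L) => [|ltLs]; last first.
  rewrite big1 => [|j _]; first by rewrite /gauss_trunc leqNgt ltLs mulr0.
  rewrite /gauss_trunc ifF ?mulr0 //; have := ltn_ord j; lia.
elim: L => [|L IH].
  rewrite leqn0 => /eqP s0; subst s.
  by rewrite big_ord_recl big_ord0 base base' addr0.
rewrite leq_eqVlt => /orP[/eqP s_eq|/[dup] ltsL leSL].
  subst s; rewrite big_ord_recr /= big1 => [|j _]; last first.
    rewrite /gauss_trunc ifF ?mulr0 //; have := ltn_ord j; lia.
  by rewrite add0r base base'.
rewrite big_ord_recr /= IH //.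
rewrite /gauss_trunc -ltnS ltsL (ltnW ltsL).
have -> : (L.+1 - s = (L - s).+1)%N by lia.
set d := (L - s)%N.
have QL : Q ^+ L.+1 = Q ^+ s * Q ^+ d.+1 by rewrite -exprD; congr (_ ^+ _); lia.
rewrite QL -mulrA -mulrDr; congr (_ * _).
have -> : qpoch (Q ^+ d.+2) Q m.+1 =
   qpoch (Q ^+ d.+2) Q m * (1 - Q ^+ d.+1 * Q ^+ m.+1).
  by rewrite /qpoch big_ord_recr /= !exprS; congr (_ * (1 - _)); ring.
have -> : qpoch (Q ^+ d.+1) Q m.+1 = (1 - Q ^+ d.+1) * qpoch (Q ^+ d.+2) Q m.
  rewrite /qpoch big_ord_recl /= mulr1; congr (_ * _).
  by apply: eq_bigr => j _; rewrite /bump /= !exprS; ring.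
rewrite qpochS; have := qpoch_neq0 Q_pow_neq1 m; have := Q_pow_neq1 m => *.
by field; apply/andP.
Qed.

(** The strict bound on the quotient at a first letter [c] amounts to raising [s] by one. *)
Lemma gauss_trunc_hockey_strict m s L :
  \sum_(j < L) Q ^+ j * gauss_trunc m s j = Q ^+ s * gauss_trunc m.+1 s.+1 L.
Proof.
case: L => [|L]; first by rewrite big_ord0 /gauss_trunc /= mulr0.
by rewrite gauss_trunc_hockey /gauss_trunc ltnS subSS.
Qed.

(* The sum over partitions of length [m], by removal of the largest part
   [k * j + d]; the next quotient is then at most [j], and less than [j] in front
   of a part of class [c]. *)
Fixpoint psum (A B C : K) (m t L : nat) : K :=
  if m is m'.+1 then
    A * \sum_(j < L.+1) Q ^+ j * psum A B C m' 0 j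
    + (if t is t'.+1 then B * \sum_(j < L.+1) Q ^+ j * psum A B C m' t' j else 0)
    + C * \sum_(j < L) Q ^+ j * psum A B C m' e j
  else 1.

Lemma psumS A B C m t L : psum A B C m.+1 t L =
    A * \sum_(j < L.+1) Q ^+ j * psum A B C m 0 j
    + (if t is t'.+1 then B * \sum_(j < L.+1) Q ^+ j * psum A B C m t' j else 0)
    + C * \sum_(j < L) Q ^+ j * psum A B C m e j.
Proof. by []. Qed.

(** The recursions match: the hockey-stick sums produce the factor [Q ^ s] that [wsum_rec] puts into
    the weight. *)
Lemma psumE A B C m t L N1 N2 : (m < N1)%N -> (m < N2)%N ->
  psum A B C m t L = wsum A B C N1 N2 m t (fun s => gauss_trunc m s L).
Proof.
elim: m t L N1 N2 => [|m IH] t L [|N1] [|N2] //.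
  move=> _ _; rewrite /wsum big_ord_recl big_ord_recl /= !big1 ?addr0.
  - rewrite /cf /= bet_rec gam0 /gauss_trunc /qpoch !big_ord0 divr1 gbinn0 //.
    rewrite bin0n subn0 !expr0 !mul1r; case: (t) => [|t']; by rewrite addr0 mulr1.
  - by move=> s _; rewrite big1 // => h _; rewrite cf_eq0 ?mulr0 ?mul0r // addnS.
  - by move=> h _; rewrite cf_eq0 ?mulr0 ?mul0r.
rewrite !ltnS => lt1 lt2.
have swap n1 n2 t1 M (g : nat -> nat -> K) :
    \sum_(j < M) Q ^+ j * wsum A B C n1 n2 m t1 (g^~ j) =
    wsum A B C n1 n2 m t1 (fun s => \sum_(j < M) Q ^+ j * g s j).
  rewrite /wsum; under eq_bigr => j _ do rewrite big_distrr /=.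
  rewrite exchange_big; apply: eq_bigr => s _ /=.
  under eq_bigr => j _ do rewrite big_distrr /=.
  rewrite exchange_big; apply: eq_bigr => h _ /=.
  by rewrite big_distrr; apply: eq_bigr => j _ /=; ring.
rewrite wsum_rec /=; congr (_ * _ + _ + _ * _).
- under eq_bigr => j _ do rewrite (IH _ _ _ _ (leqW lt1) (leqW lt2)).
  rewrite (swap _ _ _ _ (gauss_trunc m)); apply: eq_bigr => s _; apply: eq_bigr => h _.
  by rewrite gauss_trunc_hockey.
- case: t => // t; congr (_ * _).
  under eq_bigr => j _ do rewrite (IH _ _ _ _ (leqW lt1) lt2).
  rewrite (swap _ _ _ _ (gauss_trunc m)); apply: eq_bigr => s _; apply: eq_bigr => h _.
  by rewrite gauss_trunc_hockey.
- under eq_bigr => j _ do rewrite (IH _ _ _ _ lt1 (leqW lt2)).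
  rewrite (swap _ _ _ _ (gauss_trunc m)); apply: eq_bigr => s _; apply: eq_bigr => h _.
  by rewrite gauss_trunc_hockey_strict.
Qed.

End Compositions.

(** * The terms of the two series as weighted sums over words *)

Section Terms.
Variables (K : fieldType) (k a b c : nat) (q mu nu om : K).
Local Notation Q := (q ^+ k).
Hypothesis Q_pow_neq1 : forall i, 1 - Q ^+ i.+1 != 0.

Lemma qbin_gbin_tot j n s : qbin q j n%:Z s%:Z = gbin_tot (q ^+ j) n s.
Proof.
rewrite /qbin /gbin_tot /=; case: leqP => le_sn; last first.
  by rewrite ifF //; lia.
rewrite ifT; last by lia.
have -> : `|n%:Z - s%:Z|%N = (n - s)%N by lia.
by rewrite /gbin subnK // [_ * qpoch _ _ s]mulrC.
Qed.

(** With [r = e.+1], the top entry [h - r i + s] is at least [s] exactly when [r i <= h], so the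
    zero convention of [qbin] is the cutoff of [dist_shift]. *)
Lemma qbin_dist_shift e h i s :
  qbin q k (h%:Z - e.+1%:Z * i%:Z + s%:Z) s%:Z = dist_shift Q e s.+1 h i.
Proof.
rewrite /dist_shift; case: leqP => le_rh; last first.
  by rewrite /qbin ifF //; nia.
have -> : h%:Z - e.+1%:Z * i%:Z + s%:Z = (h - e.+1 * i + s)%N%:Z.
  by rewrite PoszD -subzn // PoszM.
by rewrite qbin_gbin_tot /gbin_tot leq_addl addnK.
Qed.

Lemma half_sqr_bin s : ((s ^ 2 - s) %/ 2 = 'C(s, 2))%N.
Proof. by rewrite bin2 divn2; congr _./2; case: s => // s; rewrite /=; nia. Qed.

(** The leading run has the same cap [e] as the others, so [bet e s] is [gam s.+1], and [gam_sieve]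
    gives the alternating sum. *)
Lemma term_run_wsum e m : term_run k a b c q mu nu om e.+1 m =
  wsum Q e (mu * q ^+ a) (nu * q ^+ b) (om * q ^+ c) m.+1 m.+1 m e
    (fun _ => (qpoch Q Q m)^-1).
Proof.
rewrite /term_run /wsum big_distrr; apply: eq_bigr => s _ /=.
set F := fun h : nat => (qpoch Q Q m)^-1 * (monomial k a b c q mu nu om m s h *
  qbin q k (m%:Z - h%:Z) s%:Z *
  \sum_(i < s.+2) (-1) ^+ i * q ^+ (e.+1 * k * ((i ^ 2 - i) %/ 2)) *
    qbin q (e.+1 * k) (s%:Z + 1) i%:Z *
    qbin q k (h%:Z - e.+1%:Z * i%:Z + s%:Z) s%:Z).
rewrite big_distrr /= (big_ord_widen_cond m.+1 xpredT F) ?ltnS ?leq_subr //.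
rewrite big_mkcond; apply: eq_bigr => h _ /=; rewrite {}/F.
have lt_sm := ltn_ord s; have lt_hm := ltn_ord h.
case: ltnP => hs; last by rewrite cf_eq0 ?mulr0 ?mul0r //; lia.
have le_hs : (h + s <= m)%N by lia.
rewrite /cf le_hs -gamS gam_sieve //.
have -> : m%:Z - h%:Z = (m - h)%N%:Z by rewrite -subzn //; lia.
rewrite qbin_gbin_tot /gbin_tot ifT; last by lia.
have -> : \sum_(i < s.+2) (-1) ^+ i * q ^+ (e.+1 * k * ((i ^ 2 - i) %/ 2)) *
    qbin q (e.+1 * k) (s%:Z + 1) i%:Z *
    qbin q k (h%:Z - e.+1%:Z * i%:Z + s%:Z) s%:Z = sieve Q e s.+1 h.
  apply: eq_bigr => i _; rewrite qbin_dist_shift half_sqr_bin.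
  have -> : s%:Z + 1 = s.+1%:Z by lia.
  rewrite qbin_gbin_tot -!exprM; congr (_ * q ^+ _ * gbin_tot (q ^+ _) _ _ * _).
    by rewrite mulnA [(e.+1 * k)%N]mulnC.
  by rewrite mulnC.
rewrite /monomial half_sqr_bin !exprMn !exprD -!exprM.
rewrite ![(a * _)%N]mulnC ![(b * _)%N]mulnC ![(c * _)%N]mulnC.
set x := qpoch _ _ _; ring.
Qed.

(** Since [h <= m < e.+1], only [i = 0] survives in the alternating sum. *)
Lemma term_term_run e m : (m <= e)%N ->
  term k a b c q mu nu om m = term_run k a b c q mu nu om e.+1 m.
Proof.
move=> le_me; rewrite /term /term_run; congr (_ * _).
apply: eq_bigr => s _; apply: eq_bigr => h _.
rewrite mulrAC; congr (_ * _).
rewrite big_ord_recl big1 ?addr0 => [|i _]; last first.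
  rewrite qbin_dist_shift /dist_shift ifF ?mulr0 //.
  have := ltn_ord h; rewrite lift0 mulnS.
  by move: (e.+1 * i)%N => x; lia.
rewrite /= mulr0 subr0 -[_ + 1]/((s + 1)%N%:Z) !qbin_gbin_tot /gbin_tot /= gbinn0.
  by rewrite div0n muln0 expr0 !mul1r.
move=> i; rewrite -exprM; case: k Q_pow_neq1 => [|k'] Hk.
  by have := Hk 0%N; rewrite !expr0 expr1n subrr eqxx.
have := Hk (e.+1 * i.+1).-1; rewrite -exprM.
by congr (1 - q ^+ _ != 0); nia.
Qed.

End Terms.

(** * Enumeration of the partitions *)

Section Enumeration.
Variables (k a b c : nat).
Hypotheses (ha : (1 <= a)%N) (hab : (a < b)%N) (hbc : (b < c)%N) (hck : (c <= k)%N).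

(** Residues are represented in [1..k] rather than [0..k-1], because [c = k] is allowed. *)
Lemma eq_modn_residue d d' : (0 < d <= k)%N -> (0 < d' <= k)%N ->
  (d = d' %[mod k])%N -> d = d'.
Proof.
wlog le_dd' : d d' / (d <= d')%N.
  move=> H; case: (leqP d d') => [|/ltnW] le hd hd' E; first exact: H.
  by apply/esym/H.
move=> hd hd' /esym/eqP; rewrite eqn_mod_dvd // => /dvdnP[[|z] Hz]; nia.
Qed.

Lemma residue_modn j d : (k * j + d = d %[mod k])%N.
Proof. by rewrite mulnC modnMDl. Qed.

Lemma residue_modn_eq j d d' : (0 < d <= k)%N -> (0 < d' <= k)%N ->
  (k * j + d == d' %[mod k])%N = (d == d').
Proof.
move=> hd hd'; rewrite residue_modn.
by apply/eqP/eqP => [/eq_modn_residue|->//]; apply.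
Qed.

Lemma residue_decomp x d : (0 < x)%N -> (0 < d <= k)%N -> (x = d %[mod k])%N ->
  exists j, x = (k * j + d)%N.
Proof.
move=> x_gt0 hd E; exists (x.-1 %/ k)%N.
have k_gt0 : (0 < k)%N by lia.
have := divn_eq x.-1 k; have := ltn_pmod x.-1 k_gt0.
set j := (_ %/ _)%N; set d' := (_ %% _)%N => ltd' Hx.
have Hx' : x = (k * j + d'.+1)%N by nia.
rewrite Hx'; congr (_ + _)%N; apply: eq_modn_residue => //.
by rewrite -E Hx' residue_modn.
Qed.

(** All conditions become local: in a sorted sequence a later copy of the head forces the second
    part to be a copy too, so distinctness in class [c] is a condition on neighbours. *)
Lemma Rset_cons x p : Rset a b c k (x :: p) <->
  [/\ (0 < x)%N,
      [\/ x = a %[mod k], x = b %[mod k] | x = c %[mod k]]%N,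
      Rset a b c k p &
      if p is y :: _ then
        [/\ (y <= x)%N, ~ (x = c %[mod k] /\ y = x)%N &
            (x = a %[mod k] -> y = a %[mod k] \/ y = c %[mod k])%N]
      else True].
Proof.
have geq_trans : transitive geq.
  by move=> u v w /= uv wu; apply: leq_trans wu uv.
split.
- case=> [[sx x0] abcx ux nx].
  move: x0; rewrite inE negb_or => /andP[x0 p0].
  split; first by rewrite lt0n eq_sym.
  + by apply: abcx; rewrite mem_head.
  + split.
    * by split=> //; move: sx => /=; case: (p) => //= y p' /andP[].
    * by move=> y yp; apply: abcx; rewrite inE yp orbT.
    * by move: ux => /=; case: ifP => //= _ /andP[].
    * by move=> i ip; apply: (nx i.+1).
  + case: p sx abcx ux nx {p0} => //= y p /andP[xy _] _ ux nx; split=> //.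
    * move=> [/eqP xc yx]; move: ux; rewrite yx xc /= inE eqxx.
      by [].
    * by move=> xa; apply: (nx 0%N).
- case=> x0 abcx [[sp p0] abcp up np] H.
  have sxp : sorted geq (x :: p).
    by case: p H sp {abcp up np p0} => //= y p [-> _ _] ->.
  split.
  + by split=> //; rewrite inE negb_or p0 eq_sym -lt0n x0.
  + by move=> y; rewrite inE => /orP[/eqP ->//|]; apply: abcp.
  + rewrite /=; case: ifP => // /eqP xc /=; rewrite up andbT mem_filter.
    apply/negP => /andP[_ xp]; case: p H sp xp {abcp up np p0 sxp} => // y p.
    case=> yx nyx _ /= sp; rewrite inE => /orP[/eqP xy|xp].
      by apply: nyx.
    have /allP /(_ _ xp) /= xy := order_path_min geq_trans sp.
    by apply: nyx; split=> //; apply/eqP; rewrite eqn_leq yx xy.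
  + case=> [|i] /=; last exact: np.
    by case: p H {abcp up np p0 sp sxp} => //= y p [_ _ H] _; apply: H.
Qed.

Definition no_run r (p : seq nat) := ~ (exists i, (i + r <= size p)%N /\
  forall j, (j < r)%N -> (nth 0 p (i + j) = b %[mod k])%N).

Definition lead (p : seq nat) := find (fun x => x != b %[mod k])%N p.

Lemma lead_cons x p :
  lead (x :: p) = if (x == b %[mod k])%N then (lead p).+1 else 0%N.
Proof. by rewrite /lead /=; case: eqP. Qed.

Lemma leadP r p : reflect ((r <= size p)%N /\
  forall j, (j < r)%N -> (nth 0 p j = b %[mod k])%N) (r <= lead p)%N.
Proof.
apply: (iffP idP) => [le_r|[le_r H]].
  split; first exact: leq_trans le_r (find_size _ _).
  move=> j lt_jr; apply/eqP/negPn.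
  by have /(before_find 0%N) -> := leq_trans lt_jr le_r.
rewrite leqNgt; apply/negP => lt_lr.
have has_p : has (fun x => x != b %[mod k])%N p.
  by rewrite has_find; apply: leq_trans lt_lr le_r.
by have := nth_find 0%N has_p; rewrite (H _ lt_lr) eqxx.
Qed.

Lemma no_run_nil e : no_run e.+1 [::].
Proof. by case=> i []; rewrite addnS. Qed.

(** A run starting at the head is measured by [lead]; any other run lies in the tail. *)
Lemma no_run_cons e x p :
  no_run e.+1 (x :: p) <-> no_run e.+1 p /\ (lead (x :: p) <= e)%N.
Proof.
split=> [nr|[nr le_e] [[|i] [sz H]]].
- split.
    by case=> i [sz H]; apply: nr; exists i.+1; split.
  rewrite leqNgt; apply/negP => /leadP [sz H].
  by apply: nr; exists 0%N; split.
- by move: le_e; rewrite leqNgt => /negP; apply; apply/leadP.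
- by apply: nr; exists i; split.
Qed.

Lemma no_run_lead e p : no_run e.+1 p -> (lead p <= e)%N.
Proof. by case: p => // x p /no_run_cons[]. Qed.

Lemma mem_prefixP d (s : seq nat) (P : nat -> seq (seq nat)) p :
  reflect (exists j p', [/\ j \in s, p' \in P j & p = (k * j + d)%N :: p'])
    (p \in [seq (k * j + d)%N :: p' | j <- s, p' <- P j]).
Proof.
exact: (@allpairsPdep _ (fun=> seq nat) _ (fun j p' => (k * j + d)%N :: p')).
Qed.

Variable e : nat.

(* In [parts m t L] the next part must be smaller than [k * L + c], and at most
   [t] parts congruent to [b] may come before the next part of another class. *)
Fixpoint parts (m t L : nat) : seq (seq nat) :=
  if m is m'.+1 then
    [seq (k * j + a)%N :: p | j <- index_iota 0 L.+1, p <- parts m' 0 j] ++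
    (if t is t'.+1 then
       [seq (k * j + b)%N :: p | j <- index_iota 0 L.+1, p <- parts m' t' j]
     else [::]) ++
    [seq (k * j + c)%N :: p | j <- index_iota 0 L, p <- parts m' e j]
  else [:: [::]].

Lemma partsS m t L : parts m.+1 t L =
    [seq (k * j + a)%N :: p | j <- index_iota 0 L.+1, p <- parts m 0 j] ++
    (if t is t'.+1 then
       [seq (k * j + b)%N :: p | j <- index_iota 0 L.+1, p <- parts m t' j]
     else [::]) ++
    [seq (k * j + c)%N :: p | j <- index_iota 0 L, p <- parts m e j].
Proof. by []. Qed.

Variant parts_spec m t L : seq nat -> Prop :=
| PartsA j p of (j <= L)%N & p \in parts m 0 j :
    parts_spec m t L ((k * j + a)%N :: p)
| PartsB j p of (j <= L)%N & (0 < t)%N & p \in parts m t.-1 j :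
    parts_spec m t L ((k * j + b)%N :: p)
| PartsC j p of (j < L)%N & p \in parts m e j :
    parts_spec m t L ((k * j + c)%N :: p).

Lemma partsP m t L p : reflect (parts_spec m t L p) (p \in parts m.+1 t L).
Proof.
apply: (iffP idP).
- rewrite partsS mem_cat [X in _ || X]mem_cat => /or3P[/mem_prefixP|H|/mem_prefixP].
  + move=> [j [p' [jL p'm ->]]]; apply: PartsA => //.
    by rewrite mem_index_iota in jL.
  + case: t H => // t /mem_prefixP [j [p' [jL p'm ->]]].
    by apply: PartsB => //; rewrite mem_index_iota in jL.
  + move=> [j [p' [jL p'm ->]]]; apply: PartsC => //.
    by rewrite mem_index_iota in jL.
- case=> j p' jL; rewrite partsS mem_cat [X in _ || X]mem_cat.
  + move=> p'm; apply/or3P; apply: Or31; apply/mem_prefixP; exists j, p'.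
    by rewrite mem_index_iota.
  + case: t => // t _ p'm; apply/or3P; apply: Or32; apply/mem_prefixP.
    by exists j, p'; rewrite mem_index_iota.
  + move=> p'm; apply/or3P; apply: Or33; apply/mem_prefixP; exists j, p'.
    by rewrite mem_index_iota.
Qed.

Lemma parts_uniq m t L : uniq (parts m t L).
Proof.
have hA : (0 < a <= k)%N by lia.
have hB : (0 < b <= k)%N by lia.
have hC : (0 < c <= k)%N by lia.
have inj d j1 j2 (p1 p2 : seq nat) : (0 < d <= k)%N ->
    (k * j1 + d)%N :: p1 = (k * j2 + d)%N :: p2 -> j1 = j2 /\ p1 = p2.
  by move=> hd [E ->]; split=> //; nia.
have dis d d' j j' (p p' : seq nat) : (0 < d <= k)%N -> (0 < d' <= k)%N ->
    d != d' -> (k * j + d)%N :: p = (k * j' + d')%N :: p' -> False.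
  move=> hd hd' ne [E _]; move: (residue_modn_eq j hd hd').
  by rewrite E residue_modn eqxx (negbTE ne).
have uq (d : nat) s (P : nat -> seq (seq nat)) : (0 < d <= k)%N -> uniq s ->
    (forall j, uniq (P j)) -> uniq [seq (k * j + d)%N :: p | j <- s, p <- P j].
  move=> hd us uP; apply: allpairs_uniq_dep => // -[j1 p1] [j2 p2] _ _ /=.
  by move=> /(inj _ _ _ _ _ hd) [-> ->].
elim: m t L => // m IH t L; rewrite partsS.
rewrite cat_uniq; apply/and3P; split.
- by apply: uq => //; rewrite iota_uniq.
- apply/hasPn => p; rewrite mem_cat => /orP[|].
  + case: t => // t /mem_prefixP [j [p' [_ _ ->]]].
    apply/negP => /mem_prefixP [j2 [p2 [_ _]]]; apply: dis => //; lia.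
  + move=> /mem_prefixP [j [p' [_ _ ->]]].
    apply/negP => /mem_prefixP [j2 [p2 [_ _]]]; apply: dis => //; lia.
- rewrite cat_uniq; apply/and3P; split.
  + by case: t => // t; apply: uq; rewrite ?iota_uniq.
  + apply/hasPn => p /mem_prefixP [j [p' [_ _ ->]]].
    case: t => // t; apply/negP => /mem_prefixP [j2 [p2 [_ _]]]; apply: dis => //; lia.
  + by apply: uq => //; rewrite iota_uniq.
Qed.

(** As [a < b < c <= k], this one bound says that the first quotient is at most [L] in classes [a]
    and [b], and less than [L] in class [c]. *)
Definition below L (p : seq nat) : bool :=
  if p is y :: _ then (y < k * L + c)%N else true.

Lemma leq_residue j d j' d' : (0 < d <= k)%N -> (0 < d' <= k)%N ->
  (k * j' + d' <= k * j + d)%N = (j' < j)%N || ((j' == j) && (d' <= d)%N).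
Proof. by move=> hd hd'; case: (ltngtP j' j) => [H|H|->] /=; nia. Qed.

(** The condition on the next part is [below j p] for every class [d]: when [d = b] this is the
    plain order, when [d = c] it also excludes equality, and when [d = a] the next part is not of
    class [b], which is [lead p = 0]. *)
Lemma Rset_cons_residue d j p : d \in [:: a; b; c] ->
  Rset a b c k ((k * j + d)%N :: p) <->
  [/\ Rset a b c k p, d = a -> lead p = 0%N & below j p].
Proof.
have hA : (0 < a <= k)%N by lia.
have hB : (0 < b <= k)%N by lia.
have hC : (0 < c <= k)%N by lia.
move=> d_abc.
have hd : (0 < d <= k)%N by move: d_abc; rewrite !inE => /or3P[] /eqP ->.
have modE z d1 d2 : (0 < d1 <= k)%N -> (0 < d2 <= k)%N ->
    (k * z + d1 = d2 %[mod k])%N = (d1 = d2).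
  move=> h1 h2; apply/propext; split=> [/eqP|->]; last exact: residue_modn.
  by rewrite residue_modn_eq // => /eqP.
have head_ok : (0 < k * j + d)%N /\ [\/ k * j + d = a %[mod k],
    k * j + d = b %[mod k] | k * j + d = c %[mod k]]%N.
  split; first by lia.
  move: d_abc; rewrite !inE residue_modn => /or3P[] /eqP ->.
  - exact: Or31.
  - exact: Or32.
  - exact: Or33.
case: p => [|y p].
  split=> [/Rset_cons[]//|[Rp _ _]]; apply/Rset_cons; split=> //; apply head_ok.
suff adj : Rset a b c k (y :: p) ->
    [/\ (y <= k * j + d)%N, ~ (k * j + d = c %[mod k] /\ y = k * j + d)%N &
      (k * j + d = a %[mod k] -> y = a %[mod k] \/ y = c %[mod k])%N] <->
    (d = a -> lead (y :: p) = 0%N) /\ below j (y :: p).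
  split.
    by move=> /Rset_cons [_ _ Rp] /(adj Rp) [].
  case=> Rp l0 bd; apply/Rset_cons; split=> //; try apply head_ok.
  exact/adj.
move=> /Rset_cons [y_gt0 y_abc _ _].
have [j' [d' [yE d'_abc]]] : exists j' d', y = (k * j' + d')%N /\ d' \in [:: a; b; c].
  by case: y_abc => /residue_decomp [] // j' ->;
    [exists j', a|exists j', b|exists j', c]; rewrite !inE eqxx ?orbT.
have hd' : (0 < d' <= k)%N by move: d'_abc; rewrite !inE => /or3P[] /eqP ->.
rewrite {}yE lead_cons residue_modn_eq // /below.
rewrite [(k * j' + d' < _)%N]ltnNge !leq_residue //.
rewrite !modE //; move: d_abc d'_abc; rewrite !inE => d_abc d'_abc.
split.
- case=> le nc na; split.
    by move=> /na; case: eqP => //; lia.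
  apply/negP => H; apply: nc.
  have [-> [-> ->]] : j = j' /\ d = c /\ d' = c by lia.
  by [].
- case=> l0 bd.
  have d'b : d = a -> d' != b by move=> /l0; case: eqP.
  split; first by lia.
  + case=> dc /eqP; rewrite eqn_leq !leq_residue //; lia.
  + by move=> /d'b; lia.
Qed.

(** The cap on the leading run encodes both run conditions: it is 0 after [a], drops by one after
    [b], and returns to [e] after [c]. *)
Lemma mem_parts m t L p : (t <= e)%N -> p \in parts m t L <->
  [/\ size p = m, Rset a b c k p, no_run e.+1 p, (lead p <= t)%N & below L p].
Proof.
have hA : (0 < a <= k)%N by lia.
have hB : (0 < b <= k)%N by lia.
have hC : (0 < c <= k)%N by lia.
have a_abc : a \in [:: a; b; c] by rewrite inE eqxx.
have b_abc : b \in [:: a; b; c] by rewrite !inE eqxx orbT.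
have c_abc : c \in [:: a; b; c] by rewrite !inE eqxx !orbT.
elim: m t L p => [|m IH] t L p le_te.
  split; last by case=> /size0nil ->; rewrite inE.
  rewrite inE => /eqP ->; split=> //; exact: no_run_nil.
split.
- move=> /partsP [j {}p le_jL|j {}p le_jL t_gt0|j {}p le_jL] /IH [].
  + by [].
  + move=> sz Rp nr ld bl; split; first by rewrite /= sz.
    * by apply/Rset_cons_residue => //; split=> // _; apply/eqP; rewrite -leqn0.
    * apply/no_run_cons; split=> //; rewrite lead_cons residue_modn_eq //.
      by case: eqP => //; lia.
    * by rewrite lead_cons residue_modn_eq //; case: eqP => //; lia.
    * by rewrite /below ltnNge leq_residue //; lia.
  + by lia.
  + move=> sz Rp nr ld bl; split; first by rewrite /= sz.
    * by apply/Rset_cons_residue => //; split=> // ba; lia.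
    * apply/no_run_cons; split=> //; rewrite lead_cons residue_modn_eq // eqxx; lia.
    * by rewrite lead_cons residue_modn_eq // eqxx; lia.
    * by rewrite /below ltnNge leq_residue //; lia.
  + by [].
  + move=> sz Rp nr ld bl; split; first by rewrite /= sz.
    * by apply/Rset_cons_residue => //; split=> // ba; lia.
    * apply/no_run_cons; split=> //; rewrite lead_cons residue_modn_eq //.
      by case: eqP => //; lia.
    * by rewrite lead_cons residue_modn_eq //; case: eqP => //; lia.
    * by rewrite /below ltnNge leq_residue //; lia.
- case: p => [[]//|x p] [[sz] Rx /no_run_cons [nr _] ld bl]; apply/partsP.
  have [x_gt0 x_abc _ _] := (Rset_cons x p).1 Rx.
  move: Rx ld bl; rewrite lead_cons /below ltnNge.
  case: x_abc => /residue_decomp [] // j ->;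
    rewrite residue_modn_eq // leq_residue // => /Rset_cons_residue [] // Rp l0 bl ld ltL.
  + apply: PartsA; first by lia.
    by apply/IH => //; split=> //; rewrite l0.
  + rewrite eqxx in ld.
    apply: PartsB; [lia|lia|apply/IH; first lia].
    by split=> //; lia.
  + apply: PartsC; first by lia.
    by apply/IH => //; split=> //; apply: no_run_lead.
Qed.

Section Weights.
Variables (K : fieldType) (q mu nu om : K).
Local Notation wt := (weight k a b c q mu nu om).

Lemma weight_cons x p : wt (x :: p) =
  mu ^+ (x == a %[mod k])%N * nu ^+ (x == b %[mod k])%N *
  om ^+ (x == c %[mod k])%N * q ^+ x * wt p.
Proof. by rewrite /weight /ell /= !exprD; ring. Qed.

Lemma sum_prefix d L (P : nat -> seq (seq nat)) :
  \sum_(p <- [seq (k * j + d)%N :: p | j <- index_iota 0 L, p <- P j]) wt p =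
  \sum_(j < L) \sum_(p <- P j) wt ((k * j + d)%N :: p).
Proof.
rewrite (@big_allpairs_dep _ _ _ _ (fun=> seq nat) _ (fun j p => (k * j + d)%N :: p)).
by rewrite big_mkord.
Qed.

Lemma sum_parts m t L : \sum_(p <- parts m t L) wt p =
  psum (q ^+ k) e (mu * q ^+ a) (nu * q ^+ b) (om * q ^+ c) m t L.
Proof.
have hA : (0 < a <= k)%N by lia.
have hB : (0 < b <= k)%N by lia.
have hC : (0 < c <= k)%N by lia.
have ab : (a == b) = false by lia.
have ac : (a == c) = false by lia.
have bc : (b == c) = false by lia.
elim: m t L => [|m IH] t L.
  by rewrite big_seq1 /weight /= !expr0 !mul1r.
have cat3 (s1 s2 s3 : seq (seq nat)) : \sum_(p <- s1 ++ s2 ++ s3) wt p =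
    \sum_(p <- s1) wt p + \sum_(p <- s2) wt p + \sum_(p <- s3) wt p.
  by rewrite !big_cat /= addrA.
rewrite partsS psumS cat3; congr (_ + _ + _).
- rewrite sum_prefix big_distrr; apply: eq_bigr => j _ /=.
  under eq_bigr => p _ do rewrite weight_cons !residue_modn_eq //.
  rewrite -big_distrr /= IH eqxx -exprM exprD ab ac.
  by rewrite expr1 !expr0; ring.
- case: t => [|t]; first by rewrite big_nil.
  rewrite sum_prefix big_distrr; apply: eq_bigr => j _ /=.
  under eq_bigr => p _ do rewrite weight_cons !residue_modn_eq //.
  rewrite -big_distrr /= IH eqxx -exprM exprD [b == a]eq_sym ab bc.
  by rewrite expr1 !expr0; ring.
- rewrite sum_prefix big_distrr; apply: eq_bigr => j _ /=.
  under eq_bigr => p _ do rewrite weight_cons !residue_modn_eq //.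
  rewrite -big_distrr /= IH eqxx -exprM exprD [c == a]eq_sym [c == b]eq_sym ac bc.
  by rewrite expr1 !expr0; ring.
Qed.
End Weights.

End Enumeration.

(** * Uniform bounds *)

Section Bounds.
Variable R : realType.

Lemma exists_expr_le (Q eps : R) : 0 <= Q -> Q < 1 -> 0 < eps ->
  exists n, Q ^+ n <= eps.
Proof.
move=> Q0 Q1 eps0.
have : `|Q| < 1 by rewrite ger0_norm.
move=> /cvg_expr /cvgrPdist_le /(_ _ eps0) [n _ /(_ n (leqnn n))] /=.
by rewrite sub0r normrN ger0_norm ?exprn_ge0 // => H; exists n.
Qed.

Lemma sum_eventually_halving (x : nat -> R) S0 :
  (forall s, 0 <= x s) -> (forall s, (S0 <= s)%N -> x s.+1 <= x s / 2) ->
  exists M, forall N, \sum_(s < N) x s <= M.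
Proof.
move=> x0 xh; exists (\sum_(s < S0) x s + 2 * x S0) => N.
(* The partial sum plus twice the next term does not increase. *)
have tail n : \sum_(s < S0 + n) x s + 2 * x (S0 + n)%N <= \sum_(s < S0) x s + 2 * x S0.
  elim: n => [|n IH]; first by rewrite addn0.
  apply: le_trans IH; rewrite addnS big_ord_recr /= -addrA lerD2l.
  have := xh (S0 + n)%N (leq_addr _ _); lra.
apply: le_trans (tail N); apply: le_trans (_ : \sum_(s < S0 + N) x s <= _); last first.
  by rewrite lerDl mulr_ge0.
by rewrite addnC big_split_ord /= lerDl sumr_ge0.
Qed.

Lemma theta_bound (x Q : R) : 0 <= x -> 0 <= Q -> Q < 1 ->
  exists M, forall N, \sum_(s < N) x ^+ s * Q ^+ 'C(s, 2) <= M.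
Proof.
move=> x0 Q0 Q1.
(* From this [n] on, the ratio [x Q^s] of consecutive terms is at most 1/2; the [+ 1] covers
   [x = 0]. *)
have [n Hn] : exists n, Q ^+ n <= (2 * (x + 1))^-1.
  by apply: exists_expr_le => //; rewrite invr_gt0; lra.
have xQ : x * Q ^+ n <= 2^-1.
  have := ler_wpM2l x0 Hn; rewrite invfM => /le_trans; apply.
  rewrite mulrCA ler_piMr //.
  by rewrite ler_pdivrMr; lra.
apply: (@sum_eventually_halving (fun s => x ^+ s * Q ^+ 'C(s, 2)) n) => s.
  by rewrite mulr_ge0 ?exprn_ge0.
move=> le_ns; rewrite exprS binS bin1 exprD.
have -> : x * x ^+ s * (Q ^+ 'C(s, 2) * Q ^+ s) =
  x ^+ s * Q ^+ 'C(s, 2) * (x * Q ^+ s) by ring.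
apply: ler_wpM2l; first by rewrite mulr_ge0 ?exprn_ge0.
apply: le_trans xQ; apply: ler_wpM2l => //.
by apply: ler_wiXn2l => //; apply: ltW.
Qed.

Lemma geometric_sum_le (x : R) n : 0 <= x -> x < 1 ->
  \sum_(i < n) x ^+ i <= (1 - x)^-1.
Proof.
move=> x0 x1; rewrite -[leRHS]mul1r ler_pdivlMr ?subr_gt0 //.
have -> : (\sum_(i < n) x ^+ i) * (1 - x) = 1 - x ^+ n.
  by rewrite -[1 - x ^+ n]opprB subrX1 -mulNr opprB mulrC.
by rewrite lerBlDr lerDl exprn_ge0.
Qed.

Lemma sum_shift_le (F : nat -> R) j N : (forall h, 0 <= F h) ->
  \sum_(h < N) (if (j <= h)%N then F (h - j)%N else 0) <= \sum_(h < N) F h.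
Proof.
move=> F0; case: (leqP j N) => [le_jN|lt_Nj]; last first.
  rewrite big1; first exact: sumr_ge0.
  by move=> h _; rewrite ifF //; have := ltn_ord h; lia.
rewrite -(big_mkord xpredT F).
rewrite -(big_mkord xpredT (fun h => if (j <= h)%N then F (h - j)%N else 0)).
rewrite (big_cat_nat (leq0n j) le_jN) /= big1_seq ?add0r; last first.
  move=> h; rewrite mem_index_iota => /andP[_ /andP[_ lt_hN]].
  by rewrite ifF //; lia.
rewrite -{1}[j]add0n big_addn.
rewrite [leRHS](big_cat_nat (leq0n (N - j)) (leq_subr _ _)) /=.
apply: ler_wpDr; first exact: sumr_ge0.
by apply: ler_sum => h _; rewrite leq_addl addnK.
Qed.

Variable Q : R.
Hypotheses (Q0 : 0 <= Q) (Q1 : Q < 1).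

Lemma onem_expr_gt0 i : 0 < 1 - Q ^+ i.+1.
Proof. by rewrite subr_gt0 exprn_ilt1. Qed.

Lemma qpoch_gt0 n : 0 < qpoch Q Q n.
Proof. by apply: prodr_gt0 => i _; rewrite -exprS onem_expr_gt0. Qed.

(** The infinite product is positive: past an [N] with [Q^N <= (1 - Q) / 2], the Weierstrass
    inequality bounds the remaining factors below by 1/2. *)
Lemma qpoch_bound : exists2 kap, 0 < kap & forall n, kap <= qpoch Q Q n.
Proof.
have [N HN] : exists N, Q ^+ N <= (1 - Q) / 2.
  by apply: exists_expr_le => //; rewrite divr_gt0 // subr_gt0.
have tail n : 1 - Q ^+ N * (\sum_(i < n) Q ^+ i) <= \prod_(i < n) (1 - Q ^+ (N + i).+1).
  elim: n => [|n IH]; first by rewrite !big_ord0 mulr0 subr0.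
  rewrite !big_ord_recr /=.
  set S := \sum_(i < n) _ in IH *; set P := \prod_(i < n) _ in IH *.
  have P1 : P <= 1.
    rewrite /P; apply: prodr_ile1 => i _.
    by rewrite ltW ?onem_expr_gt0 //= lerBlDr lerDl exprn_ge0.
  have -> : Q ^+ (N + n).+1 = Q * (Q ^+ N * Q ^+ n) by rewrite exprS exprD.
  have E0 : 0 <= Q ^+ N * Q ^+ n by rewrite mulr_ge0 ?exprn_ge0.
  set z := Q ^+ N * Q ^+ n in E0 *; rewrite mulrDr -/z mulrBr mulr1.
  have zP : P * (Q * z) <= z.
    apply: le_trans (_ : 1 * (Q * z) <= _); first by rewrite ler_wpM2r // mulr_ge0.
    by rewrite mul1r ler_piMl // ltW.
  lra.
have geo n := geometric_sum_le n Q0 Q1.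
have tail2 n : 2^-1 <= \prod_(i < n) (1 - Q ^+ (N + i).+1).
  apply: le_trans (tail n).
  have : Q ^+ N * (\sum_(i < n) Q ^+ i) <= (1 - Q) / 2 * (1 - Q)^-1.
    by apply: ler_pM => //; rewrite ?exprn_ge0 ?sumr_ge0 // => i _; rewrite exprn_ge0.
  rewrite mulrAC divff ?mul1r; last by rewrite subr_eq0 gt_eqF.
  lra.
exists (qpoch Q Q N / 2); first by rewrite divr_gt0 ?qpoch_gt0.
move=> n.
have mono m : qpoch Q Q (n + m) <= qpoch Q Q n.
  rewrite /qpoch big_split_ord /= ler_piMr //.
    by have := qpoch_gt0 n; rewrite /qpoch => /ltW.
  apply: prodr_ile1 => i _; rewrite -exprS ltW ?onem_expr_gt0 //=.
  by rewrite lerBlDr lerDl exprn_ge0.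
apply: le_trans (mono N); rewrite addnC /qpoch big_split_ord /=.
apply: ler_wpM2l; first by have := qpoch_gt0 N; rewrite /qpoch => /ltW.
apply: le_trans (tail2 n) _; rewrite le_eqVlt; apply/orP; left; apply/eqP.
by apply: eq_bigr => i _; rewrite -exprS.
Qed.

Lemma qpoch_shift_le1 d n : qpoch (Q ^+ d.+1) Q n <= 1.
Proof.
apply: prodr_ile1 => i _; rewrite -exprD addSn ltW ?onem_expr_gt0 //=.
by rewrite lerBlDr lerDl exprn_ge0.
Qed.

Lemma qpoch_shift_ge0 d n : 0 <= qpoch (Q ^+ d.+1) Q n.
Proof.
by apply: prodr_ge0 => i _; rewrite -exprD addSn ltW ?onem_expr_gt0.
Qed.

Lemma gbin_ge0 n s : 0 <= gbin Q n s.
Proof. by rewrite /gbin divr_ge0 ?mulr_ge0 // ltW ?qpoch_gt0. Qed.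

Lemma gbin_le n s : gbin Q n s <= (qpoch Q Q s)^-1.
Proof.
rewrite /gbin invfM mulrA ler_piMl ?invr_ge0 ?(ltW (qpoch_gt0 _)) //.
rewrite ler_pdivrMr ?qpoch_gt0 // mul1r /qpoch big_split_ord /= ler_piMr //.
  by have := qpoch_gt0 n; rewrite /qpoch => /ltW.
rewrite (eq_bigr (fun i : 'I_s => 1 - Q ^+ n.+1 * Q ^+ i)); last first.
  by move=> i _; rewrite -exprS -exprD addSn.
exact: qpoch_shift_le1.
Qed.

Lemma gauss_trunc_ge0 m s L : 0 <= gauss_trunc Q m s L.
Proof.
rewrite /gauss_trunc; case: ifP => // _.
by rewrite divr_ge0 ?qpoch_shift_ge0 // ltW ?qpoch_gt0.
Qed.

Lemma gauss_trunc_le m s L : gauss_trunc Q m s L <= (qpoch Q Q m)^-1.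
Proof.
have inv0 : 0 <= (qpoch Q Q m)^-1 by rewrite invr_ge0 ltW ?qpoch_gt0.
rewrite /gauss_trunc; case: ifP => // _.
by rewrite ler_piMl ?qpoch_shift_le1.
Qed.

Lemma gam_ge0 e s h : 0 <= gam Q e s h.
Proof.
elim: s h => [|s IH] h /=; first by rewrite ler0n.
by apply: sumr_ge0 => j _; rewrite mulr_ge0 ?exprn_ge0.
Qed.

(** Bounding the powers of [Q] by 1 makes the segments independent, and each contributes at most
    [Gam]. *)
Lemma gam_sum_le (B Gam : R) e s N : 0 <= B -> \sum_(j < e.+1) B ^+ j <= Gam ->
  \sum_(h < N) B ^+ h * gam Q e s h <= Gam ^+ s.
Proof.
move=> B0 HG.
have Gam0 : 0 <= Gam.
  by apply: le_trans HG; apply: sumr_ge0 => j _; rewrite exprn_ge0.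
elim: s => [|s IH].
  rewrite expr0; case: N => [|N]; first by rewrite big_ord0.
  by rewrite big_ord_recl /= big1 ?mulr1 ?addr0 // => i _; rewrite mulr0.
pose F h := B ^+ h * gam Q e s h.
have F0 h : 0 <= F h by rewrite mulr_ge0 ?exprn_ge0 ?gam_ge0.
apply: le_trans (_ : \sum_(j < e.+1) B ^+ j * (\sum_(h < N) F h) <= _); last first.
  rewrite -big_distrl /= exprS; apply: ler_pM => //.
    by apply: sumr_ge0 => j _; rewrite exprn_ge0.
  exact: sumr_ge0.
under eq_bigr => h _ do rewrite /= big_distrr big_mkcond /=.
rewrite exchange_big; apply: ler_sum => j _.
apply: le_trans (_ : B ^+ j * \sum_(h < N) (if (j <= h)%N then F (h - j)%N else 0) <= _).
  rewrite big_distrr /=; apply: ler_sum => h _; case: ifP => le_jh; last by rewrite mulr0.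
  have -> : B ^+ h = B ^+ j * B ^+ (h - j) by rewrite -exprD subnKC.
  have -> : B ^+ j * B ^+ (h - j) * (Q ^+ (s * j) * gam Q e s (h - j)) =
    B ^+ j * F (h - j)%N * Q ^+ (s * j) by rewrite /F; ring.
  apply: ler_piMr; last by rewrite exprn_ile1 // ltW.
  by rewrite mulr_ge0 // exprn_ge0.
by rewrite ler_wpM2l ?exprn_ge0 // sum_shift_le.
Qed.

Lemma gam_mono e e' s h : (e <= e')%N -> gam Q e s h <= gam Q e' s h.
Proof.
move=> le_e; elim: s h => [|s IH] h //=.
rewrite [leLHS](big_ord_widen_cond e'.+1 (fun j => (j <= h)%N)
  (fun j => Q ^+ (s * j) * gam Q e s (h - j))) //.
rewrite big_mkcond [leRHS]big_mkcond; apply: ler_sum => j _ /=.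
have pos : 0 <= Q ^+ (s * j) * gam Q e' s (h - j).
  by rewrite mulr_ge0 ?exprn_ge0 ?gam_ge0.
case: ifP => [/andP[-> _]|_]; first by rewrite ler_wpM2l ?exprn_ge0.
by case: ifP.
Qed.

(** Each of the two q-binomial factors is at most [kap^-1]. Summing over [m] then gives a geometric
    series in [A], over [h] the factor [Gam^(s+1)], and over [s] a partial theta series in [C Gam].
    Only [Gam] constrains [B], so [B >= 1] is allowed when runs are bounded. *)
Lemma psum_bound (A B C Gam : R) : 0 <= A -> A < 1 -> 0 <= B -> 0 <= C -> 0 <= Gam ->
  exists M, forall (e : nat -> nat) E N L, (forall m, (m < N)%N -> (e m <= E)%N) ->
    \sum_(j < E.+1) B ^+ j <= Gam ->
    \sum_(m < N) psum Q (e m) A B C m (e m) L <= M.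
Proof.
move=> A0 A1 B0 C0 Gam0.
have [kap kap0 Hkap] := qpoch_bound.
have [M HM] := theta_bound (mulr_ge0 C0 Gam0) Q0 Q1.
have Qn i : 1 - Q ^+ i.+1 != 0 by rewrite gt_eqF ?onem_expr_gt0.
have kapV n : (qpoch Q Q n)^-1 <= kap^-1 by rewrite lef_pV2 ?posrE ?qpoch_gt0.
have kapV0 : 0 <= kap^-1 by rewrite invr_ge0 ltW.
exists (kap^-1 * kap^-1 * ((1 - A)^-1 * (Gam * M))) => e E N L le_eE HG.
pose w s h := C ^+ s * Q ^+ 'C(s, 2) * (B ^+ h * gam Q E s.+1 h).
have w0 s h : 0 <= w s h by rewrite !mulr_ge0 ?exprn_ge0 ?gam_ge0.
apply: le_trans (_ : \sum_(m < N) \sum_(s < N) \sum_(h < N)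
    kap^-1 * kap^-1 * w s h * (if (h + s <= m)%N then A ^+ (m - (h + s)) else 0) <= _).
  apply: ler_sum => m _; rewrite (psumE _ Qn _ _ _ _ _ (ltn_ord m) (ltn_ord m)).
  apply: ler_sum => s _; apply: ler_sum => h _; rewrite /cf.
  case: ifP => _; last by rewrite !mulr0 mul0r.
  rewrite -gamS subnDA.
  apply: le_trans (_ : A ^+ (m - h - s) * B ^+ h * C ^+ s *
    (Q ^+ 'C(s, 2) * gbin Q (m - h - s) s * gam Q E s.+1 h) * gauss_trunc Q m s L <= _).
    apply: ler_wpM2r; first exact: gauss_trunc_ge0.
    apply: ler_wpM2l; first by rewrite !mulr_ge0 ?exprn_ge0.
    apply: ler_wpM2l; first by rewrite mulr_ge0 ?exprn_ge0 ?gbin_ge0.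
    exact/gam_mono/le_eE.
  have -> : A ^+ (m - h - s) * B ^+ h * C ^+ s *
    (Q ^+ 'C(s, 2) * gbin Q (m - h - s) s * gam Q E s.+1 h) * gauss_trunc Q m s L =
    gbin Q (m - h - s) s * gauss_trunc Q m s L * (w s h * A ^+ (m - h - s)).
    by rewrite /w; ring.
  rewrite -[leRHS]mulrA; apply: ler_wpM2r; first by rewrite mulr_ge0 ?exprn_ge0.
  apply: ler_pM; rewrite ?gbin_ge0 ?gauss_trunc_ge0 //.
    exact: le_trans (gbin_le _ _) (kapV _).
  exact: le_trans (gauss_trunc_le _ _ _) (kapV _).
rewrite exchange_big /=; under eq_bigr => s _ do rewrite exchange_big /=.
apply: le_trans (_ : \sum_(s < N) \sum_(h < N)
    kap^-1 * kap^-1 * w s h * (1 - A)^-1 <= _).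
  apply: ler_sum => s _; apply: ler_sum => h _; rewrite -big_distrr /=.
  apply: ler_wpM2l; first by apply: mulr_ge0 => //; apply: mulr_ge0.
  apply: le_trans (geometric_sum_le N A0 A1).
  by apply: (@sum_shift_le (fun n => A ^+ n)) => n; rewrite exprn_ge0.
apply: le_trans (_ : \sum_(s < N)
   kap^-1 * kap^-1 * ((1 - A)^-1 * (Gam * ((C * Gam) ^+ s * Q ^+ 'C(s, 2)))) <= _).
  apply: ler_sum => s _.
  under eq_bigr => h _ do rewrite -mulrA [w _ _ * _]mulrC.
  rewrite -!big_distrr /=; apply: ler_wpM2l; first by rewrite mulr_ge0.
  apply: ler_wpM2l; first by rewrite invr_ge0 subr_ge0 ltW.
  have -> : Gam * ((C * Gam) ^+ s * Q ^+ 'C(s, 2)) =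
    C ^+ s * Q ^+ 'C(s, 2) * Gam ^+ s.+1 by rewrite exprMn exprS; ring.
  apply: ler_wpM2l; first by rewrite mulr_ge0 ?exprn_ge0.
  exact: (gam_sum_le s.+1 N B0 HG).
rewrite -!big_distrr /=; apply: ler_wpM2l; first by rewrite mulr_ge0.
apply: ler_wpM2l; first by rewrite invr_ge0 subr_ge0 ltW.
by apply: ler_wpM2l => //; apply: HM.
Qed.

End Bounds.

(** * Limits and unconditional sums *)

Section Limit.
Variables (K : numFieldType) (Q : K).
Hypothesis Q_cvg0 : (fun n => Q ^+ n : K^o) @ \oo --> (0 : K^o).
Hypothesis Q_pow_neq1 : forall i, 1 - Q ^+ i.+1 != 0.

Lemma cvg_gauss_trunc m s :
  (fun L => gauss_trunc Q m s L : K^o) @ \oo --> ((qpoch Q Q m)^-1 : K^o).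
Proof.
have prod_cvg n : (fun L => qpoch (Q ^+ L.+1) Q n : K^o) @ \oo --> (1 : K^o).
  elim: n => [|n IH].
    by under eq_fun do rewrite /qpoch big_ord0; apply: cvg_cst.
  have qS : (fun L => qpoch (Q ^+ L.+1) Q n.+1 : K^o) =
      (fun L => qpoch (Q ^+ L.+1) Q n * (1 - Q ^+ L.+1 * Q ^+ n) : K^o).
    by apply/funext => L; rewrite /qpoch big_ord_recr.
  have shift : (fun L => Q ^+ L.+1 : K^o) @ \oo --> (0 : K^o).
    by rewrite (cvg_shiftS (fun n => Q ^+ n : K^o)).
  have one : (fun L => 1 - Q ^+ L.+1 * Q ^+ n : K^o) @ \oo --> (1 - 0 * Q ^+ n : K^o).
    apply: (@cvgB K K^o); first exact: cvg_cst.
    by apply: (@cvgM K) => //; exact: cvg_cst.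
  have E : 1 = 1 * (1 - 0 * Q ^+ n) :> K by rewrite mul0r subr0 mulr1.
  rewrite qS.
  have H : (fun L => qpoch (Q ^+ L.+1) Q n * (1 - Q ^+ L.+1 * Q ^+ n) : K^o) @ \oo
      --> (1 * (1 - 0 * Q ^+ n) : K^o) by apply: (@cvgM K).
  by rewrite -E in H.
(* The shift by [s] removes the truncation. *)
rewrite -(cvg_shiftn s).
have -> : (fun L => gauss_trunc Q m s (L + s)%N : K^o) =
    (fun L => qpoch (Q ^+ L.+1) Q m * (qpoch Q Q m)^-1 : K^o).
  by apply/funext => L; rewrite /gauss_trunc leq_addl addnK.
have H : (fun L => qpoch (Q ^+ L.+1) Q m * (qpoch Q Q m)^-1 : K^o) @ \oo
    --> (1 * (qpoch Q Q m)^-1 : K^o).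
  by apply: (@cvgM K); [exact: prod_cvg|exact: cvg_cst].
by rewrite mul1r in H.
Qed.

Lemma cvg_sum_nat (I : Type) (r : seq I) (f : I -> nat -> K^o) (l : I -> K^o) :
  (forall i, f i @ \oo --> l i) ->
  (fun L => \sum_(i <- r) f i L) @ \oo --> \sum_(i <- r) l i.
Proof.
move=> fl; elim: r => [|i r IH].
  by rewrite big_nil; under eq_fun do rewrite big_nil; apply: cvg_cst.
rewrite big_cons; under eq_fun do rewrite big_cons.
exact: (@cvgD K K^o).
Qed.

Lemma cvg_psum e A B C m t : (fun L => psum Q e A B C m t L : K^o) @ \oo -->
  (wsum Q e A B C m.+1 m.+1 m t (fun _ => (qpoch Q Q m)^-1) : K^o).
Proof.
under eq_fun do rewrite (psumE _ Q_pow_neq1 _ _ _ _ _ (ltnSn m) (ltnSn m)).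
rewrite /wsum.
apply: cvg_sum_nat => s; apply: cvg_sum_nat => h.
by apply: (@cvgM K); [exact: cvg_cst|exact: cvg_gauss_trunc].
Qed.
End Limit.

(** * Convergence of complex sequences with real radii *)

Section ComplexSequences.
Variable R : realType.

(** Positive elements of [R[i]] are real, so real radii suffice in limits. *)
Lemma gtc0_Re (eps : R[i]) : 0 < eps -> 0 < complex.Re eps /\ (complex.Re eps)%:C = eps.
Proof.
move=> eps0; have E : (complex.Re eps)%:C = eps by apply: RRe_real; apply: gtr0_real.
by split=> //; rewrite -ltcR E.
Qed.

Lemma cvg_seq_complexP (u : nat -> R[i]) (l : R[i]) :
  (u : nat -> R[i]^o) @ \oo --> (l : R[i]^o) <->
  forall eps : R, 0 < eps ->
    exists n0, forall n, (n0 <= n)%N -> `|l - u n| <= eps%:C.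
Proof.
split.
- move=> /cvgrPdist_le H eps eps0.
  have epsC : 0 < eps%:C :> R[i] by rewrite ltcR.
  by have [n0 _ Hn] := H _ epsC; exists n0 => n /Hn.
- move=> H; apply/cvgrPdist_le => eps /gtc0_Re [eps0 <-].
  by have [n0 Hn] := H _ eps0; exists n0 => // n /Hn.
Qed.

Lemma normc_le_ReIm (x : R[i]) : `|x| <= (`|complex.Re x| + `|complex.Im x|)%:C.
Proof.
have normR (y : R) : `|y%:C| = `|y|%:C :> R[i].
  by rewrite normc_def /= expr0n /= addr0 sqrtr_sqr.
rewrite {1}[x]complexE; apply: le_trans (ler_normD _ _) _.
rewrite normrM !normR rmorphD /=.
have -> : `|'i%C| = 1 :> R[i].
  by rewrite normc_def /= expr0n /= add0r expr1n sqrtr1.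
by rewrite mul1r.
Qed.

Lemma normc_ge_Im (x : R[i]) : `|complex.Im x|%:C <= `|x|.
Proof.
rewrite normc_def lecR -sqrtr_sqr ler_sqrt; last by rewrite addr_ge0 ?sqr_ge0.
by rewrite lerDr sqr_ge0.
Qed.

Lemma real_cauchy_cvg (v : nat -> R) :
  (forall eps : R, 0 < eps ->
    exists n0, forall n, (n0 <= n)%N -> `|v n - v n0| <= eps) ->
  exists l, forall eps, 0 < eps ->
    exists n0, forall n, (n0 <= n)%N -> `|l - v n| <= eps.
Proof.
move=> H; have /cauchy_cvgP/cvg_ex [l Hl] : cauchy (v @ \oo).
  apply: cauchy_exP => eps eps0.
  (* Halving turns the weak inequality into membership in an open ball. *)
  have [n0 Hn] := H _ (divr_gt0 eps0 (ltr0n _ 2)).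
  exists (v n0), n0 => // n /Hn; rewrite distrC /ball /= => /le_lt_trans; apply.
  by rewrite ltr_pdivrMr // ltr_pMr // ltr1n.
exists l => eps eps0; move/cvgrPdist_le: Hl => /(_ _ eps0) [n0 _ Hn].
by exists n0 => n /Hn.
Qed.

Lemma complex_cauchy_cvg (u : nat -> R[i]) :
  (forall eps : R, 0 < eps ->
    exists n0, forall n, (n0 <= n)%N -> `|u n - u n0| <= eps%:C) ->
  exists l : R[i], (u : nat -> R[i]^o) @ \oo --> (l : R[i]^o).
Proof.
move=> H.
have [x Hx] : exists l, forall eps, 0 < eps ->
    exists n0, forall n, (n0 <= n)%N -> `|l - complex.Re (u n)| <= eps.
  apply: real_cauchy_cvg => eps /H [n0 Hn]; exists n0 => n /Hn.
  by move=> /(le_trans (normc_ge_Re _)); rewrite lecR raddfB.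
have [y Hy] : exists l, forall eps, 0 < eps ->
    exists n0, forall n, (n0 <= n)%N -> `|l - complex.Im (u n)| <= eps.
  apply: real_cauchy_cvg => eps /H [n0 Hn]; exists n0 => n /Hn.
  by move=> /(le_trans (normc_ge_Im _)); rewrite lecR raddfB.
exists (x +i* y); apply/cvg_seq_complexP => eps eps0.
have eps2 : 0 < eps / 2 by rewrite divr_gt0.
have [n1 H1] := Hx _ eps2; have [n2 H2] := Hy _ eps2.
exists (maxn n1 n2) => n; rewrite geq_max => /andP[/H1 le1 /H2 le2].
apply: le_trans (normc_le_ReIm _) _; rewrite lecR !raddfB /=.
by rewrite [eps]splitr lerD.
Qed.

End ComplexSequences.

(** * Unconditional summation over an exhaustion by finite blocks *)

Section Blocks.
Variables (R : realType) (T : choiceType) (sz : T -> nat) (A : set T).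
Variables (f : T -> R[i]) (g : T -> R) (F : nat -> nat -> seq T).
Variables (t : nat -> R[i]) (M : R).
Hypotheses (normf : forall p, `|f p| = (g p)%:C)
  (F_uniq : forall m L, uniq (F m L))
  (F_sz : forall m L p, p \in F m L -> sz p = m)
  (F_sub : forall m L p, p \in F m L -> A p)
  (F_mono : forall m L L', (L <= L')%N -> {subset F m L <= F m L'})
  (F_exh : forall p, A p -> exists L, p \in F (sz p) L)
  (F_bound : forall N L, \sum_(m < N) \sum_(p <- F m L) g p <= M)
  (F_cvg : forall m,
    (fun L => \sum_(p <- F m L) f p : R[i]^o) @ \oo --> (t m : R[i]^o)).

Fixpoint union (N L : nat) : seq T :=
  if N is N'.+1 then union N' L ++ F N' L else [::].

Lemma sum_union (V : zmodType) (h : T -> V) N L :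
  \sum_(p <- union N L) h p = \sum_(m < N) \sum_(p <- F m L) h p.
Proof.
by elim: N => [|N IH] /=; rewrite ?big_nil ?big_ord0 // big_cat big_ord_recr IH.
Qed.

Lemma mem_union p N L : (p \in union N L) = (sz p < N)%N && (p \in F (sz p) L).
Proof.
elim: N => [|N IH] //=; rewrite mem_cat IH.
case: (boolP (p \in F N L)) => [pF|pF].
  by rewrite (F_sz pF) ltnn ltnS leqnn pF.
rewrite orbF; case: (ltngtP (sz p) N) => [lt|lt|eq].
- by rewrite ltnS ltnW.
- by rewrite ltnS leqNgt lt.
- by rewrite eq (negbTE pF) ?andbF /= ?andbF.
Qed.

Lemma union_uniq N L : uniq (union N L).
Proof.
elim: N => //= N IH; rewrite cat_uniq IH F_uniq andbT /=.
apply/hasPn => p /F_sz pN; apply/negP; rewrite /= mem_union.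
by rewrite pN ltnn.
Qed.

Lemma union_mono N N' L L' : (N <= N')%N -> (L <= L')%N ->
  {subset union N L <= union N' L'}.
Proof.
move=> leN leL p; rewrite !mem_union => /andP[lt pF].
by rewrite (leq_trans lt leN) (F_mono leL).
Qed.

Lemma union_exhaust (s : seq T) : (forall p, p \in s -> A p) ->
  exists N, forall N', (N <= N')%N -> {subset s <= union N' N'}.
Proof.
elim: s => [|p s IH] As; first by exists 0%N.
have [N HN] := IH (fun p' p's => As _ (mem_behead (p's : p' \in behead (p :: s)))).
have [L HL] := F_exh (As _ (mem_head _ _)).
exists (maxn N (maxn (sz p).+1 L)) => N'; rewrite !geq_max => /and3P[leN lts leL].
move=> p'; rewrite inE => /orP[/eqP ->|]; last exact: HN.
by rewrite mem_union lts (F_mono leL).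
Qed.

Lemma g_ge0 p : 0 <= g p.
Proof. by rewrite -lecR -normf normr_ge0. Qed.

Lemma sum_sub_uniq (V : zmodType) (h : T -> V) (X Y : seq T) :
  uniq X -> uniq Y -> {subset X <= Y} ->
  \sum_(p <- Y) h p = \sum_(p <- X) h p + \sum_(p <- Y | p \notin X) h p.
Proof.
move=> uX uY sXY; rewrite (bigID (mem X)) /=; congr (_ + _).
rewrite -big_filter; apply: perm_big; apply: uniq_perm => //.
  exact: filter_uniq.
by move=> p; rewrite mem_filter; case: (boolP (p \in X)) => [/sXY ->|].
Qed.

Lemma norm_sum_sub (X Y : seq T) : uniq X -> uniq Y -> {subset X <= Y} ->
  `|\sum_(p <- Y) f p - \sum_(p <- X) f p| <=
    (\sum_(p <- Y) g p - \sum_(p <- X) g p)%:C.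
Proof.
move=> uX uY sXY; rewrite !(sum_sub_uniq _ uX uY sXY) !(addrC (\sum_(p <- X) _)) !addrK.
apply: le_trans (ler_norm_sum _ _ _) _; rewrite rmorph_sum /=.
by under eq_bigr do rewrite normf.
Qed.

Lemma sum_sub_le (X Y : seq T) : uniq X -> uniq Y -> {subset X <= Y} ->
  \sum_(p <- X) g p <= \sum_(p <- Y) g p.
Proof.
move=> uX uY sXY; rewrite (sum_sub_uniq _ uX uY sXY) lerDl.
by apply: sumr_ge0 => p _; apply: g_ge0.
Qed.

(** The sums of [g] over the sets [union N N] are bounded; once one is within [eps] of their
    supremum, any finite superset adds at most [eps], as it lies in a larger [union N N]. *)
Lemma sum_cauchy (eps : R) : 0 < eps -> exists N0, forall Y : seq T, uniq Y ->
  (forall p, p \in Y -> A p) -> {subset union N0 N0 <= Y} ->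
  `|\sum_(p <- Y) f p - \sum_(p <- union N0 N0) f p| <= eps%:C.
Proof.
move=> eps0.
pose E : set R := range (fun N => \sum_(p <- union N N) g p).
have supE : has_sup E.
  split; first by exists (\sum_(p <- union 0 0) g p), 0%N.
  by exists M => _ [N _ <-]; rewrite sum_union.
have [_ [N0 _ <-] HN0] := sup_adherent eps0 supE.
exists N0 => Y uY AY sY; apply: le_trans (norm_sum_sub (union_uniq _ _) uY sY) _.
rewrite lecR lerBlDr.
have [N HN] := union_exhaust AY.
have := sum_sub_le uY (union_uniq _ _) (HN _ (leqnn _)) => /le_trans; apply.
have : \sum_(p <- union N N) g p <= sup E.
  by apply: ub_le_sup; [case: supE | exists N].
by move: HN0; rewrite ltrBlDr => /ltW /[swap] /le_trans H /H; rewrite addrC.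
Qed.

Lemma union_sub N L p : p \in union N L -> A p.
Proof. by rewrite mem_union => /andP[_ /F_sub]. Qed.

(** Partial sums of [t] and sums over large finite subsets are both close to the sum over one
    [union N0 N0], hence have the same limit. *)
Lemma sums_to_blocks : exists S : R[i],
  sums_to A f S /\
  (fun n => \sum_(0 <= m < n) t m : R[i]^o) @ \oo --> (S : R[i]^o).
Proof.
have partial n (eps : R) : 0 < eps -> exists L0, forall L, (L0 <= L)%N ->
    `|\sum_(0 <= m < n) t m - \sum_(p <- union n L) f p| <= eps%:C.
  move=> eps0.
  have /cvg_seq_complexP /(_ _ eps0) :
      (fun L => \sum_(m < n) \sum_(p <- F m L) f p : R[i]^o) @ \oo -->
      (\sum_(m < n) t m : R[i]^o) by apply: cvg_sum_nat.
  case=> L0 H; exists L0 => L /H; by rewrite big_mkord sum_union.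
have close (eps : R) : 0 < eps -> exists N0,
    (forall n, (N0 <= n)%N ->
      `|\sum_(0 <= m < n) t m - \sum_(p <- union N0 N0) f p| <= (eps + eps)%:C) /\
    (forall Y : seq T, uniq Y ->
      (forall p, p \in Y -> A p) -> {subset union N0 N0 <= Y} ->
      `|\sum_(p <- Y) f p - \sum_(p <- union N0 N0) f p| <= eps%:C).
  move=> eps0; have [N0 HN0] := sum_cauchy eps0; exists N0; split=> // n le_n.
  have [L0 HL0] := partial n _ eps0.
  have HL := HL0 _ (leq_maxl L0 N0).
  have HU := HN0 _ (union_uniq n (maxn L0 N0)) (@union_sub _ _)
     (union_mono le_n (leq_maxr L0 N0)).
  rewrite -[_ - _](subrKA (\sum_(p <- union n (maxn L0 N0)) f p)).
  by apply: le_trans (ler_normD _ _) _; rewrite rmorphD lerD.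
have [S HS] : exists S : R[i],
    (fun n => \sum_(0 <= m < n) t m : R[i]^o) @ \oo --> (S : R[i]^o).
  apply: complex_cauchy_cvg => eps eps0.
  (* [close] costs twice its radius and is used for both [n] and [N0]. *)
  have [N0 [H _]] := close _ (divr_gt0 eps0 (ltr0n R 4)).
  exists N0 => n /H Hn; have HN0 := H _ (leqnn N0).
  rewrite -[_ - _](subrKA (\sum_(p <- union N0 N0) f p)).
  apply: le_trans (ler_normD _ _) _; rewrite [X in _ + X]distrC.
  apply: le_trans (lerD Hn HN0) _; rewrite -rmorphD lecR; lra.
have totF := @summability.totally_filter A.
exists S; split=> //; apply/cvgrPdist_le => eps /gtc0_Re [eps0 <-].
set ep := complex.Re eps in eps0 *.
have ep4 : 0 < ep / 4 by rewrite divr_gt0.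
have [N0 [Hn HY]] := close _ ep4.
(* One quarter comes from the limit and two from [close]; the last is left for the finite
   subsets. *)
have SN0 : `|S - \sum_(p <- union N0 N0) f p| <= (ep / 4 + (ep / 4 + ep / 4))%:C.
  have [n1 Hn1] := (cvg_seq_complexP _ _).1 HS _ ep4.
  rewrite -[_ - _](subrKA (\sum_(0 <= m < maxn n1 N0) t m)).
  apply: le_trans (ler_normD _ _) _; rewrite rmorphD; apply: lerD.
    exact: Hn1 (leq_maxl _ _).
  exact: Hn (leq_maxr _ _).
(* All of [union N0 N0] lies in [A], so [insub] loses no element. *)
exists [fset x in pmap insub (union N0 N0)]%fset => // J /= sJ.
rewrite /summability.partial_sum -(big_seq_fsetE _ J xpredT (fun x : A => f (val x))) /=.
rewrite -(big_map (val : A -> T) xpredT f).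
set Y := [seq val x | x <- J].
have uY : uniq Y by rewrite map_inj_uniq ?fset_uniq //; exact: val_inj.
have AY p : p \in Y -> A p.
  by move=> /mapP [x _ ->]; apply/set_mem; apply: valP.
have sY : {subset union N0 N0 <= Y}.
  move=> p pU; have pA : p \in A by apply/mem_set; apply: union_sub pU.
  apply/mapP; exists (Sub p pA); rewrite ?SubK //.
  apply: (fsubsetP sJ); rewrite !inE mem_pmap.
  by apply/mapP; exists p => //; rewrite insubT.
rewrite -[_ - _](subrKA (\sum_(p <- union N0 N0) f p)).
apply: le_trans (ler_normD _ _) _; rewrite [X in _ + X]distrC.
apply: le_trans (lerD SN0 (HY _ uY AY sY)) _; rewrite -rmorphD lecR; lra.
Qed.

End Blocks.

(** The norm of [R[i]] takes values in [R[i]]; this is the modulus in [R], where the bounds on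
    [psum] apply. *)
Definition cnorm (R : realType) (x : R[i]) : R := complex.Re `|x|.

Section ComplexNorm.
Variable R : realType.
Implicit Types x q : R[i].

Lemma cnormE x : `|x| = (cnorm x)%:C.
Proof. by rewrite /cnorm RRe_real ?normr_real. Qed.

Lemma cnorm_ge0 x : 0 <= cnorm x.
Proof. by rewrite -lecR -cnormE normr_ge0. Qed.

Lemma cnorm_lt1 x q n : `|x * q ^+ n| < 1 -> cnorm x * cnorm q ^+ n < 1.
Proof.
rewrite normrM normrX !cnormE -rmorphXn -rmorphM.
by rewrite -[1]/(1%:C) ltcR.
Qed.

Lemma norm_weight k a b c q mu nu om p : `|weight k a b c q mu nu om p| =
  (weight k a b c (cnorm q) (cnorm mu) (cnorm nu) (cnorm om) p)%:C.
Proof. by rewrite /weight !normrM !normrX !cnormE !rmorphM !rmorphXn. Qed.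

Lemma norm_exprE q n : `|q ^+ n| = (cnorm q ^+ n)%:C.
Proof. by rewrite normrX cnormE rmorphXn. Qed.

Lemma onem_expr_neq0 q i : `|q| < 1 -> 1 - q ^+ i.+1 != 0.
Proof.
move=> hq; rewrite subr_eq0; apply/eqP => E.
have : `|q ^+ i.+1| < 1 by rewrite normrX exprn_ilt1.
by rewrite -E normr1 ltxx.
Qed.

Lemma cvg_expr_complex q : `|q| < 1 ->
  (fun n => q ^+ n : R[i]^o) @ \oo --> (0 : R[i]^o).
Proof.
move=> hq; apply/cvg_seq_complexP => eps eps0.
have q1 : cnorm q < 1 by move: hq; rewrite cnormE -[1]/(1%:C) ltcR.
have [n0 Hn0] := exists_expr_le (cnorm_ge0 q) q1 eps0.
exists n0 => n le_n; rewrite sub0r normrN norm_exprE lecR; apply: le_trans Hn0.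
by apply: ler_wiXn2l; rewrite ?cnorm_ge0 // ltW.
Qed.

End ComplexNorm.

(** * Summation with a run bound that depends on the length *)

Section RunBoundedSums.
Variables (R : realType) (k a b c : nat) (q mu nu om : R[i]).
Hypotheses (ha : (1 <= a)%N) (hab : (a < b)%N) (hbc : (b < c)%N) (hck : (c <= k)%N).
Hypotheses (hq : `|q| < 1) (hmu : `|mu * q ^+ a| < 1).

Lemma normQ_lt1 : `|q ^+ k| < 1.
Proof. by rewrite normrX exprn_ilt1 //; lia. Qed.

Let Q_pow_neq1 i : 1 - (q ^+ k) ^+ i.+1 != 0.
Proof. exact: onem_expr_neq0 normQ_lt1. Qed.

Lemma term_run0 e : term_run k a b c q mu nu om e.+1 0 = 1.
Proof.
rewrite term_run_wsum //.
apply: etrans (esym (psumE e Q_pow_neq1 (mu * q ^+ a) (nu * q ^+ b) (om * q ^+ c)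
  e 0 (ltn0Sn 0) (ltn0Sn 0))).
rewrite /wsum !big_ord1; congr (_ * _).
by rewrite /gauss_trunc /= /qpoch !big_ord0 divr1 invr1.
Qed.

(* The run bound [e] may depend on the length of the partition, so that
   [e m = m] imposes no restriction on runs: both identities are instances. *)
Lemma Rset_run_sums (X : set (seq nat)) (e : nat -> nat) (Gam : R) :
  (forall p, X p <-> Rset_run a b c k (e (size p)).+1 p) -> 0 <= Gam ->
  (forall N, exists2 E, forall m, (m < N)%N -> (e m <= E)%N &
     \sum_(j < E.+1) (cnorm nu * cnorm q ^+ b) ^+ j <= Gam) ->
  exists S : R[i], sums_to X (weight k a b c q mu nu om) (1 + S) /\
    series_from1_to (fun m => term_run k a b c q mu nu om (e m).+1 m) S.
Proof.
move=> XE Gam0 bnd.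
have q0 := cnorm_ge0 q.
have Q1 : cnorm q ^+ k < 1.
  by have := normQ_lt1; rewrite norm_exprE -[1]/(1%:C) ltcR.
have [M HM] := psum_bound (exprn_ge0 k q0) Q1
  (mulr_ge0 (cnorm_ge0 mu) (exprn_ge0 a q0)) (cnorm_lt1 hmu)
  (mulr_ge0 (cnorm_ge0 nu) (exprn_ge0 b q0))
  (mulr_ge0 (cnorm_ge0 om) (exprn_ge0 c q0)) Gam0.
pose t m := term_run k a b c q mu nu om (e m).+1 m.
have memF m L p : p \in parts k a b c (e m) m (e m) L <->
    [/\ size p = m, X p & below k c L p].
  split.
    move=> /(mem_parts ha hab hbc hck _ _ _ (leqnn _)) [sz Rp nr _ bl].
    by split=> //; apply/XE; rewrite sz; split.
  move=> [sz /XE [Rp nr] bl]; have {}nr : no_run k b (e m).+1 p by rewrite -sz.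
  by apply/(mem_parts ha hab hbc hck _ _ _ (leqnn _)); split=> //; apply: no_run_lead.
have [S [HS1 HS2]] : exists S : R[i],
    sums_to X (weight k a b c q mu nu om) S /\
    (fun n => \sum_(0 <= m < n) t m : R[i]^o) @ \oo --> (S : R[i]^o).
  apply: (@sums_to_blocks R _ size X _
    (weight k a b c (cnorm q) (cnorm mu) (cnorm nu) (cnorm om))
    (fun m L => parts k a b c (e m) m (e m) L) t M).
  - exact: norm_weight.
  - by move=> m L; apply: parts_uniq.
  - by move=> m L p /memF [].
  - by move=> m L p /memF [].
  - move=> m L L' le_L p /memF [sz Xp bl]; apply/memF; split=> //.
    case: (p) bl => //= y p' lt_y; apply: leq_trans lt_y _.
    by rewrite leq_add2r leq_mul2l le_L orbT.
  (* The first part [y] itself serves as quotient bound, as [y < k * y + c]. *)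
  - move=> p Xp; exists (head 0%N p); apply/memF; split=> //.
    by case: (p) => //= y p'; nia.
  - move=> N L; have [E le_E HE] := bnd N.
    under eq_bigr => m _ do rewrite sum_parts //.
    exact: HM le_E HE.
  - move=> m; rewrite /t term_run_wsum //.
    under eq_fun do rewrite sum_parts //.
    by apply: cvg_psum => //; apply/cvg_expr_complex/normQ_lt1.
have SE : 1 + (S - 1) = S by ring.
exists (S - 1); split; first by rewrite SE.
apply/cvg_seq_complexP => eps eps0.
have [n0 Hn0] := (cvg_seq_complexP _ _).1 HS2 _ eps0.
(* Taking [n > 0] allows the term [m = 0], which is 1, to be split off. *)
exists n0.+1 => n lt_n; have := Hn0 n (ltnW lt_n).
have n_gt0 : (0 < n)%N by lia.
rewrite (big_ltn n_gt0) /t term_run0.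
by rewrite opprD addrA.
Qed.

End RunBoundedSums.

Local Close Scope classical_set_scope.

Theorem theorem1p5 (R : realType) (k a b c r : nat) (q mu nu om : R[i])
    (ha : (1 <= a)%N) (hab : (a < b)%N) (hbc : (b < c)%N) (hck : (c <= k)%N)
    (hr : (1 <= r)%N) (hq : `|q| < 1) (hmu : `|mu * q ^+ a| < 1) :
  (`|nu * q ^+ b| < 1 ->
     exists S : R[i],
       sums_to (Rset a b c k) (weight k a b c q mu nu om) (1 + S) /\
       series_from1_to (term k a b c q mu nu om) S) /\
  (exists S : R[i],
     sums_to (Rset_run a b c k r) (weight k a b c q mu nu om) (1 + S) /\
     series_from1_to (term_run k a b c q mu nu om r) S).
Proof.
split.
- move=> hnu; have B1 := cnorm_lt1 hnu.
  have B0 : 0 <= cnorm nu * cnorm q ^+ b.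
    by rewrite mulr_ge0 ?exprn_ge0 ?cnorm_ge0.
  have -> : term k a b c q mu nu om =
      (fun m => term_run k a b c q mu nu om m.+1 m).
    apply/funext => m; apply: term_term_run => //.
    by move=> i; apply: onem_expr_neq0; rewrite normrX exprn_ilt1 //; lia.
  (* A partition of length [m] has no run of [m + 1] parts. The caps being unbounded, [Gam] is the
     full geometric series, which needs [|nu q^b| < 1]. *)
  apply: (@Rset_run_sums R k a b c q mu nu om ha hab hbc hck hq hmu _ id
    (1 - cnorm nu * cnorm q ^+ b)^-1).
  + move=> p; split=> [Rp|[]//]; split=> // -[i []].
    by rewrite addnS ltnNge leq_addl.
  + by rewrite invr_ge0 subr_ge0 ltW.
  + move=> N; exists N; first by move=> m /ltnW.
    exact: geometric_sum_le.
- case: r hr => // e _.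
  (* With the cap [e] fixed, [Gam] is a finite sum for every [nu]. *)
  apply: (@Rset_run_sums R k a b c q mu nu om ha hab hbc hck hq hmu _ (fun=> e)
    (\sum_(j < e.+1) (cnorm nu * cnorm q ^+ b) ^+ j)) => //.
  + by apply: sumr_ge0 => j _; rewrite exprn_ge0 // mulr_ge0 ?exprn_ge0 ?cnorm_ge0.
  + by move=> N; exists e.
Qed.
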